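(* If the agents are restricted to a fixed, given order in which they move (i.e. the agents that carry the message must do so in the prescribed order, each agent either not participating or carrying the message once from a pick-up location to a drop-off location, where handovers may occur at vertices or at points inside edges), then BudgetedDelivery (both the Returning and the Non-Returning version) is solvable in time $\mathcal{O}(k(n+m)(n\log n+m))$, where $n$, $m$ and $k$ are the numbers of vertices, edges and agents.
   Context: BudgetedDelivery: we are given an undirected graph $G=(V,E)$ with $n=|V|$, $m=|E|$, non-negative edge weights $w(e)$ (the energy needed to traverse edge $e$ in either direction; traversing a fraction of an edge costs the corresponding fraction of its weight), two vertices $s\neq t$, and $k$ mobile agents, agent $i$ starting at vertex $p_i$ with an energy budget $B_i\ge 0$ bounding its total travelled distance. A message is initially at $s$. An agent can pick up the message at its current location, carry it, and drop it at any location (a vertex or a point inside an edge), where another agent may later pick it up. A schedule is feasible if the message is delivered from $s$ to $t$ and no agent exceeds its budget. In the Returning version each agent must additionally end at its starting position $p_i$ within its budget; in the Non-Returning version agents may end anywhere. *)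

(* Defs.v *)
(** Budgeted delivery of a message by mobile agents moving in a fixed order,
    and a cost model (additive real RAM, presented as a while language) in
    which running times are measured. *)
From mathcomp Require Import all_boot all_order all_algebra all_fingroup.

Set Implicit Arguments.
Unset Strict Implicit.
Unset Printing Implicit Defensive.

Import Order.TTheory GRing.Theory Num.Theory.
Local Open Scope ring_scope.

Inductive version := Returning | NonReturning.

(** Edges are numbered in an arbitrary order and [ends e] lists the two end
    points of [e] in an arbitrary order: neither choice carries information
    about the undirected graph.  [turn j] is the agent that comes in [j]-th
    position in the prescribed order. *)
Record instance (R : realFieldType) := Instance {
  nV : nat;
  nE : nat;
  nA : nat;
  ends : 'I_nE -> 'I_nV * 'I_nV;
  weight : 'I_nE -> R;
  source : 'I_nV;
  target : 'I_nV;
  start : 'I_nA -> 'I_nV;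
  budget : 'I_nA -> R;
  turn : 'S_nA;
  loopless : forall e, (ends e).1 != (ends e).2;
  no_parallel : forall e f, e != f ->
    (ends f != ends e) && (ends f != ((ends e).2, (ends e).1));
  weight_ge0 : forall e, 0 <= weight e;
  budget_ge0 : forall i, 0 <= budget i;
  source_neq_target : source != target
}.

Section Delivery.
Variables (R : realFieldType) (G : instance R).

(** The locations are the [AtVertex u] and the [Inside e x] with [0 < x < 1].
    Values [Inside e x] with [x] outside this range denote nothing; no walk
    from a vertex ever leads to one. *)
Inductive location :=
  | AtVertex of 'I_(nV G)
  | Inside of 'I_(nE G) & R.

(** The point at fraction [x] of [e], measured from [(ends e).1]. *)
Definition point (e : 'I_(nE G)) (x : R) : location :=
  if x == 0 then AtVertex (ends e).1
  else if x == 1 then AtVertex (ends e).2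
  else Inside e x.

(** [walk p q c]: one can move from [p] to [q] travelling total distance [c],
    by finitely many moves, each within a single edge (or part of it). *)
Inductive walk : location -> location -> R -> Prop :=
  | walk_nil p : walk p p 0
  | walk_move e x y q c :
      0 <= x <= 1 -> 0 <= y <= 1 -> walk (point e y) q c ->
      walk (point e x) q (`|y - x| * weight e + c).

(** Agent [i] walks to the pick-up location [p], carries the message from
    there to the drop-off location [q] and, if required, returns. *)
Definition can_carry (v : version) (i : 'I_(nA G)) (p q : location) : Prop :=
  let home := AtVertex (start i) in
  match v with
  | NonReturning => exists a b,
      [/\ walk home p a, walk p q b & a + b <= budget i]
  | Returning => exists a b c,
      [/\ walk home p a, walk p q b, walk q home c & a + b + c <= budget i]
  end.

(** [handover v l p q]: the agents of [l], in this order, can bring the message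
    from [p] to [q], each of them carrying it at most once. *)
Inductive handover (v : version) :
    seq 'I_(nA G) -> location -> location -> Prop :=
  | handover_nil p : handover v [::] p p
  | handover_idle i l p q : handover v l p q -> handover v (i :: l) p q
  | handover_carry i l p q r :
      can_carry v i p q -> handover v l q r -> handover v (i :: l) p r.

Definition fixed_order_delivery (v : version) : Prop :=
  handover v [seq turn G j | j <- enum 'I_(nA G)]
    (AtVertex (source G)) (AtVertex (target G)).

End Delivery.

(** Programs.  Variables and arrays are named by natural numbers; a program
    mentions finitely many of them.  Indices are natural numbers with addition
    and truncated subtraction only (no multiplication or shift, so that large
    integers cannot be used to compute in bulk); reals are exact, with addition,
    subtraction, halving and comparison, and cannot be converted to indices. *)
Inductive iexp :=
  | ICst of nat
  | IVar of nat
  | IGet of nat & iexp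
  | IAdd of iexp & iexp
  | ISub of iexp & iexp.

Inductive rexp :=
  | RZero
  | RVar of nat
  | RGet of nat & iexp
  | RAdd of rexp & rexp
  | RSub of rexp & rexp
  | RHalf of rexp.

Inductive bexp :=
  | ILe of iexp & iexp
  | RLe of rexp & rexp
  | BNot of bexp
  | BAnd of bexp & bexp.

Inductive cmd :=
  | Skip
  | ISet of nat & iexp
  | IPut of nat & iexp & iexp
  | RSet of nat & rexp
  | RPut of nat & iexp & rexp
  | Seq of cmd & cmd
  | If of bexp & cmd & cmd
  | While of bexp & cmd.

(** The cost of an evaluation is the number of nodes evaluated. *)
Fixpoint icost (e : iexp) : nat :=
  match e with
  | ICst _ | IVar _ => 1
  | IGet _ e1 => (icost e1).+1
  | IAdd e1 e2 | ISub e1 e2 => (icost e1 + icost e2).+1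
  end.

Fixpoint rcost (e : rexp) : nat :=
  match e with
  | RZero | RVar _ => 1
  | RGet _ e1 => (icost e1).+1
  | RAdd e1 e2 | RSub e1 e2 => (rcost e1 + rcost e2).+1
  | RHalf e1 => (rcost e1).+1
  end.

Fixpoint bcost (b : bexp) : nat :=
  match b with
  | ILe e1 e2 => (icost e1 + icost e2).+1
  | RLe e1 e2 => (rcost e1 + rcost e2).+1
  | BNot b1 => (bcost b1).+1
  | BAnd b1 b2 => (bcost b1 + bcost b2).+1
  end.

Definition upd (T : Type) (f : nat -> T) (x : nat) (a : T) : nat -> T :=
  fun y => if y == x then a else f y.

Section Semantics.
Variable R : realFieldType.

Record state := State {
  ivar : nat -> nat;
  iarr : nat -> nat -> nat;
  rvar : nat -> R;
  rarr : nat -> nat -> R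
}.

Fixpoint ieval (s : state) (e : iexp) : nat :=
  match e with
  | ICst n => n
  | IVar x => ivar s x
  | IGet a e1 => iarr s a (ieval s e1)
  | IAdd e1 e2 => (ieval s e1 + ieval s e2)%N
  | ISub e1 e2 => (ieval s e1 - ieval s e2)%N
  end.

Fixpoint reval (s : state) (e : rexp) : R :=
  match e with
  | RZero => 0
  | RVar x => rvar s x
  | RGet a e1 => rarr s a (ieval s e1)
  | RAdd e1 e2 => reval s e1 + reval s e2
  | RSub e1 e2 => reval s e1 - reval s e2
  | RHalf e1 => reval s e1 / 2
  end.

Fixpoint beval (s : state) (b : bexp) : bool :=
  match b with
  | ILe e1 e2 => (ieval s e1 <= ieval s e2)%N
  | RLe e1 e2 => reval s e1 <= reval s e2
  | BNot b1 => ~~ beval s b1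
  | BAnd b1 b2 => beval s b1 && beval s b2
  end.

Definition set_ivar s x n :=
  State (upd (ivar s) x n) (iarr s) (rvar s) (rarr s).
Definition set_iarr s a i n :=
  State (ivar s) (upd (iarr s) a (upd (iarr s a) i n)) (rvar s) (rarr s).
Definition set_rvar s x r :=
  State (ivar s) (iarr s) (upd (rvar s) x r) (rarr s).
Definition set_rarr s a i r :=
  State (ivar s) (iarr s) (rvar s) (upd (rarr s) a (upd (rarr s a) i r)).

(** [exec p s c s']: run from [s], [p] halts in [s'] after [c] steps. *)
Inductive exec : cmd -> state -> nat -> state -> Prop :=
  | exec_skip s : exec Skip s 1 s
  | exec_iset s x e : exec (ISet x e) s (icost e).+1 (set_ivar s x (ieval s e))
  | exec_iput s a e1 e2 :
      exec (IPut a e1 e2) s (icost e1 + icost e2).+1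
        (set_iarr s a (ieval s e1) (ieval s e2))
  | exec_rset s x e : exec (RSet x e) s (rcost e).+1 (set_rvar s x (reval s e))
  | exec_rput s a e1 e2 :
      exec (RPut a e1 e2) s (icost e1 + rcost e2).+1
        (set_rarr s a (ieval s e1) (reval s e2))
  | exec_seq s s1 s2 p1 p2 c1 c2 :
      exec p1 s c1 s1 -> exec p2 s1 c2 s2 ->
      exec (Seq p1 p2) s (c1 + c2).+1 s2
  | exec_if s s1 b p1 p2 c :
      exec (if beval s b then p1 else p2) s c s1 ->
      exec (If b p1 p2) s (bcost b + c).+1 s1
  | exec_while_false s b p :
      ~~ beval s b -> exec (While b p) s (bcost b).+1 s
  | exec_while_true s s1 s2 b p c1 c2 :
      beval s b -> exec p s c1 s1 -> exec (While b p) s1 c2 s2 ->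
      exec (While b p) s (bcost b + c1 + c2).+1 s2.

Lemma exec_det p s c1 s1 c2 s2 :
  exec p s c1 s1 -> exec p s c2 s2 -> c1 = c2 /\ s1 = s2.
Proof.
move=> H; elim: H c2 s2 => {p s c1 s1};
  try by (move=> *; match goal with H : exec _ _ _ _ |- _ => inversion H end).
- move=> s s1 s2 p1 p2 c1 c2 _ IH1 _ IH2 c s' H.
  inversion H as [| | | | |? ? ? ? ? ? ? E1 E2| | |]; subst.
  by case: (IH1 _ _ E1) => -> E; subst; case: (IH2 _ _ E2) => -> ->.
- move=> s s1 b p1 p2 c _ IH c' s' H.
  inversion H as [| | | | | |? ? ? ? ? ? E| |]; subst.
  by case: (IH _ _ E) => -> ->.
- move=> s b p Hb c s' H.
  by inversion H as [| | | | | | | |? ? ? ? ? ? ? E]; subst => //; rewrite E in Hb.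
- move=> s s1 s2 b p c1 c2 Hb _ IH1 _ IH2 c s' H.
  inversion H as [| | | | | | |? ? ? E|? ? ? ? ? ? ? _ E1 E2]; subst.
    by rewrite Hb in E.
  by case: (IH1 _ _ E1) => -> E; subst; case: (IH2 _ _ E2) => -> ->.
Qed.

Definition tabulate (T : Type) (d : T) (n : nat) (f : 'I_n -> T) (i : nat) : T :=
  if insub i is Some j then f j else d.

(** The input is the edge list and the agent list; every cell not holding part
    of the input is initially zero. *)
Definition input (G : instance R) : state := State
  (nth 0%N [:: nV G; nE G; nA G; nat_of_ord (source G); nat_of_ord (target G)])
  (nth (fun=> 0%N)
     [:: tabulate 0%N (fun e : 'I_(nE G) => nat_of_ord (ends e).1);
         tabulate 0%N (fun e : 'I_(nE G) => nat_of_ord (ends e).2);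
         tabulate 0%N (fun i : 'I_(nA G) => nat_of_ord (start i));
         tabulate 0%N (fun j : 'I_(nA G) => nat_of_ord (turn G j))])
  (fun=> 0)
  (nth (fun=> 0)
     [:: tabulate 0 (fun e : 'I_(nE G) => weight e);
         tabulate 0 (fun i : 'I_(nA G) => budget i)]).

Definition accepts (s : state) : bool := ivar s 0 != 0%N.

End Semantics.

(* Main.v *)
(** The places to which the first agents can bring the message are described by
    the set of reached vertices together with, for each dart (oriented edge) with
    a reached tail, the farthest point that can be reached from that tail.  An
    agent may pick the message up at the first reached place on its way: either a
    reached vertex, or the farthest point of a dart entered from its head.  Given
    all distances between vertices, the least energy [c u] which an agent needs
    to bring the message to [u] is thus a minimum over the vertices and the darts,
    and the new farthest points follow from [c] by an explicit formula; this
    takes O(n(n+m)) steps per agent.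

    The distances are computed once, by [n] runs of Dijkstra's algorithm with a
    tournament tree, in time O(n(n+m) log n), which is within the bound.  As the
    length of some walk from the source to [u] is known for each vertex [u] of
    its component, the sums of two such lengths are valid initial values, so that
    no infinite distance has to be represented. *)
Require Import Defs.
From mathcomp Require Import all_boot all_order all_algebra all_fingroup.
From mathcomp Require Import zify lra.

Set Implicit Arguments.
Unset Strict Implicit.
Unset Printing Implicit Defensive.

Import Order.TTheory GRing.Theory Num.Theory.

(** * Running times of programs *)

(** The invariant is deliberately lopsided. Schedules are exhibited only for reached vertices and
    farthest points, whereas completeness only says that every place where the message can be lies
    in the region these span. The two fit together because an agent starts at a vertex: it enters a
    dart by the tail, itself a reached place, or by the head, and then it meets the farthest point
    before any other point counted for this dart. Positions on darts are stored as energies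
    [z * weight], not as fractions, for the machine cannot divide one real by another; halving is
    what the Returning version needs, where the stretch just carried may be walked again on the way
    home. Time is measured relative to a constant read off the syntax of the program, so the proofs
    only count iterations. The distance table is built before any agent moves; its cost is charged
    to a single agent, which is where [0 < nA G] comes in. *)

Fixpoint imods (p : cmd) : seq nat :=
  match p with
  | ISet x _ => [:: x]
  | Seq p q | If _ p q => imods p ++ imods q
  | While _ p => imods p
  | _ => [::]
  end.

Fixpoint iamods (p : cmd) : seq nat :=
  match p with
  | IPut a _ _ => [:: a]
  | Seq p q | If _ p q => iamods p ++ iamods q
  | While _ p => iamods p
  | _ => [::]
  end.

Fixpoint rmods (p : cmd) : seq nat :=
  match p with
  | RSet x _ => [:: x]
  | Seq p q | If _ p q => rmods p ++ rmods q
  | While _ p => rmods p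
  | _ => [::]
  end.

Fixpoint ramods (p : cmd) : seq nat :=
  match p with
  | RPut a _ _ => [:: a]
  | Seq p q | If _ p q => ramods p ++ ramods q
  | While _ p => ramods p
  | _ => [::]
  end.

Fixpoint loopfree (p : cmd) : bool :=
  match p with
  | Seq p q | If _ p q => loopfree p && loopfree q
  | While _ _ => false
  | _ => true
  end.

(** The constant hidden in the running time of [p]: the cost of one passage
    through [p] in which no loop body is repeated. *)
Fixpoint weightc (p : cmd) : nat :=
  match p with
  | Skip => 1
  | ISet _ e => (icost e).+1
  | IPut _ e1 e2 => (icost e1 + icost e2).+1
  | RSet _ e => (rcost e).+1
  | RPut _ e1 e2 => (icost e1 + rcost e2).+1
  | Seq p q => (weightc p + weightc q).+1
  | If b p q => (bcost b + (weightc p + weightc q)).+1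
  | While b p => (bcost b + weightc p).+1
  end.

Definition ILt (e1 e2 : iexp) : bexp := ILe (IAdd e1 (ICst 1)) e2.
Definition IEq (e1 e2 : iexp) : bexp := BAnd (ILe e1 e2) (ILe e2 e1).
Definition Incr (i : nat) : cmd := ISet i (IAdd (IVar i) (ICst 1)).
Definition Upto (i b : nat) (p : cmd) : cmd :=
  While (ILt (IVar i) (IVar b)) (Seq p (Incr i)).
Definition For (i b : nat) (p : cmd) : cmd := Seq (ISet i (ICst 0)) (Upto i b p).

Arguments upd T f x a y /.

Section Logic.
Variable R : realFieldType.
Implicit Types (s : state R) (p q : cmd).

(** The last case also sends [While] to the identity; [exec_run] ties [run] to [exec] only for
    [loopfree] commands. *)
Fixpoint run p s : state R :=
  match p with
  | ISet x e => set_ivar s x (ieval s e)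
  | IPut a e1 e2 => set_iarr s a (ieval s e1) (ieval s e2)
  | RSet x e => set_rvar s x (reval s e)
  | RPut a e1 e2 => set_rarr s a (ieval s e1) (reval s e2)
  | Seq p q => run q (run p s)
  | If b p q => if beval s b then run p s else run q s
  | _ => s
  end.

(** The modified names are computed from the syntax, so for a concrete program each side condition
    reduces to [true] and is proved by [isT]. *)
Record frame p s s' : Prop := Frame {
  frame_i : forall x, x \notin imods p -> ivar s' x = ivar s x;
  frame_ia : forall x, x \notin iamods p -> iarr s' x = iarr s x;
  frame_r : forall x, x \notin rmods p -> rvar s' x = rvar s x;
  frame_ra : forall x, x \notin ramods p -> rarr s' x = rarr s x }.

Lemma frame_refl p s : frame p s s.
Proof. by split. Qed.

Lemma frame_trans p s1 s2 s3 : frame p s1 s2 -> frame p s2 s3 -> frame p s1 s3.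
Proof.
case=> i1 a1 r1 b1 [i2 a2 r2 b2]; split=> x xP.
- by rewrite i2 ?i1. - by rewrite a2 ?a1.
- by rewrite r2 ?r1. - by rewrite b2 ?b1.
Qed.

Lemma frame_mono p q s s' :
  {subset imods p <= imods q} -> {subset iamods p <= iamods q} ->
  {subset rmods p <= rmods q} -> {subset ramods p <= ramods q} ->
  frame p s s' -> frame q s s'.
Proof.
move=> si sa sr sb [Hi Ha Hr Hb]; split=> x xP.
- by apply: Hi; apply: contra xP => /si.
- by apply: Ha; apply: contra xP => /sa.
- by apply: Hr; apply: contra xP => /sr.
- by apply: Hb; apply: contra xP => /sb.
Qed.

Lemma frame_while b p s s' : frame p s s' -> frame (While b p) s s'.
Proof. exact: frame_mono. Qed.

Lemma frame_exec p s T s' : exec p s T s' -> frame p s s'.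
Proof.
elim=> {p s T s'}.
- by move=> s; apply: frame_refl.
- move=> s x e; split=> //= y; rewrite inE /upd => /negbTE-> //.
- move=> s x e1 e2; split=> //= y; rewrite inE /upd => /negbTE-> //.
- move=> s x e; split=> //= y; rewrite inE /upd => /negbTE-> //.
- move=> s x e1 e2; split=> //= y; rewrite inE /upd => /negbTE-> //.
- move=> s s1 s2 p q c1 c2 _ F1 _ F2; apply: (@frame_trans _ _ s1).
  + by apply: frame_mono F1 => x /=; rewrite mem_cat => ->.
  + by apply: frame_mono F2 => x /=; rewrite mem_cat => ->; rewrite orbT.
- move=> s s1 b p q c _; case: ifP => _; apply: frame_mono => x /=;
    by rewrite mem_cat => ->; rewrite ?orbT.
- by move=> s b p _; apply: frame_refl.
- by move=> s s1 s2 b p c1 c2 _ _ F1 _; apply: frame_trans; apply: frame_while F1.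
Qed.

(** Total correctness with a time bound. The fuel [F] multiplies the constant [weightc p]; since
    [weightc] adds over sequences, both halves of [Seq p q] may use the same [F], and only loops
    make it grow. *)
Definition term p s F (Q : state R -> Prop) : Prop :=
  exists T s', [/\ exec p s T s', T <= weightc p * F & Q s'].

Lemma term_weaken p s F F' (Q Q' : state R -> Prop) :
  F <= F' -> (forall s', frame p s s' -> Q s' -> Q' s') ->
  term p s F Q -> term p s F' Q'.
Proof.
move=> FF QQ [T [s' [E TF Qs]]]; exists T, s'; split=> //.
  by apply: leq_trans TF _; rewrite leq_mul2l FF orbT.
by apply: QQ => //; apply: frame_exec E.
Qed.

Lemma term_seq p q s F (Q : state R -> Prop) :
  0 < F -> term p s F (fun s1 => term q s1 F Q) -> term (Seq p q) s F Q.
Proof.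
move=> F0 [T1 [s1 [E1 T1F [T2 [s2 [E2 T2F Qs]]]]]].
exists (T1 + T2).+1, s2; split=> //; first exact: exec_seq E1 E2.
by rewrite /= mulSn mulnDl -addn1 addnC leq_add // leq_add.
Qed.

Lemma term_if b p q s F (Q : state R -> Prop) :
  0 < F -> (beval s b -> term p s F Q) -> (~~ beval s b -> term q s F Q) ->
  term (If b p q) s F Q.
Proof.
move=> F0 Hp Hq.
suff [T [s' [E TF Qs]]] : exists T s', [/\ exec (if beval s b then p else q) s T s',
    T <= (weightc p + weightc q) * F & Q s'].
  exists (bcost b + T).+1, s'; split=> //; first exact: exec_if E.
  by rewrite /= mulSn mulnDl -addn1 addnC leq_add // leq_add // leq_pmulr.
case: ifP => Hb; [have [T [s' [E TF Qs]]] := Hp Hb|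
                  have [T [s' [E TF Qs]]] := Hq (negbT Hb)];
  exists T, s'; split=> //; apply: leq_trans TF _; rewrite leq_mul2r.
  by rewrite leq_addr orbT.
by rewrite leq_addl orbT.
Qed.

Lemma exec_run p s : loopfree p -> exists2 T, exec p s T (run p s) & T <= weightc p.
Proof.
elim: p s => //=.
- by move=> s _; exists 1 => //; constructor.
- by move=> x e s _; exists (icost e).+1 => //; constructor.
- by move=> a e1 e2 s _; exists (icost e1 + icost e2).+1 => //; constructor.
- by move=> x e s _; exists (rcost e).+1 => //; constructor.
- by move=> a e1 e2 s _; exists (icost e1 + rcost e2).+1 => //; constructor.
- move=> p IHp q IHq s /andP[/(IHp s)[T1 E1 H1] /(IHq (run p s))[T2 E2 H2]].
  by exists (T1 + T2).+1; [apply: exec_seq E1 E2 | rewrite ltnS leq_add].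
- move=> b p IHp q IHq s /andP[/(IHp s)[T1 E1 H1] /(IHq s)[T2 E2 H2]].
  case: ifP => Hb.
    exists (bcost b + T1).+1; first by apply: exec_if; rewrite Hb.
    by rewrite ltnS leq_add2l (leq_trans H1) // leq_addr.
  exists (bcost b + T2).+1; first by apply: exec_if; rewrite Hb.
  by rewrite ltnS leq_add2l (leq_trans H2) // leq_addl.
Qed.

Lemma term_run p s F (Q : state R -> Prop) :
  loopfree p -> 0 < F -> Q (run p s) -> term p s F Q.
Proof.
move=> lf F0 Qs; have [T E HT] := exec_run s lf.
by exists T, (run p s); split=> //; rewrite (leq_trans HT) // leq_pmulr.
Qed.

(** [I f s]: the loop can be completed from [s] within [f] units of time. *)
Lemma term_while b p s0 s f (I : nat -> state R -> Prop) (Q : state R -> Prop) :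
  (forall f s, frame (While b p) s0 s -> I f s -> ~~ beval s b -> 0 < f /\ Q s) ->
  (forall f s, frame (While b p) s0 s -> I f s -> beval s b ->
     exists f1 f2, [/\ 0 < f1, f1 + f2 <= f & term p s f1 (I f2)]) ->
  frame (While b p) s0 s -> I f s -> term (While b p) s f Q.
Proof.
(* Each passage through the body spends [f1 > 0] units, so induction on a bound for the credit
   yields termination together with the time. *)
move=> Hout Hin; elim: f {-2}f (leqnn f) s => [|f0 IH] f ff s Fs If.
  have [Hb|Hb] := boolP (beval s b); last by have [] := Hout _ _ Fs If Hb; lia.
  by have [f1 [f2 [? ? _]]] := Hin _ _ Fs If Hb; lia.
have [Hb|Hb] := boolP (beval s b); last first.
  have [f1 Qs] := Hout _ _ Fs If Hb.
  exists (bcost b).+1, s; split=> //; first exact: exec_while_false.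
  by rewrite /=; apply: leq_trans (leq_pmulr _ f1); rewrite ltnS leq_addr.
have [f1 [f2 [f1p f12 [T1 [s1 [E1 H1 I1]]]]]] := Hin _ _ Fs If Hb.
have [|T2 [s2 [E2 H2 Qs]]] := IH f2 _ s1 (frame_trans Fs (frame_while b (frame_exec E1))) I1.
  by lia.
exists (bcost b + T1 + T2).+1, s2; split=> //; first exact: exec_while_true E1 E2.
move: H1 H2 => /=; move: (weightc p) (bcost b) => w c H1 H2.
apply: leq_trans (_ : (c + w).+1 * (f1 + f2) <= _); last by rewrite leq_mul2l f12 orbT.
rewrite mulnDr; have : c * 1 <= c * f1 by rewrite leq_mul2l f1p orbT.
by move: H2; rewrite !mulSn !mulnDl; lia.
Qed.

(** Amortised version: [I j f s] leaves [f] units for the iterations from the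
    [j]-th on. *)
Lemma term_upto_credit i b p s f a N (I : nat -> nat -> state R -> Prop)
    (Q : state R -> Prop) :
  i \notin imods p -> b \notin imods p -> b != i ->
  ivar s i = a -> ivar s b = N -> a <= N -> I a f s ->
  (forall f s', frame (Upto i b p) s s' -> I N f s' -> 0 < f /\ Q s') ->
  (forall j f s', a <= j < N -> frame (Upto i b p) s s' -> ivar s' i = j ->
     I j f s' -> exists f1 f2, [/\ 0 < f1, f1 + f2 <= f &
       term p s' f1 (fun s2 => I j.+1 f2 (set_ivar s2 i j.+1))]) ->
  term (Upto i b p) s f Q.
Proof.
move=> ip bp bi sa sb aN I0 Hout Hin.
have bn : b \notin imods (Upto i b p).
  by rewrite /= mem_cat inE (negbTE bp) (negbTE bi).
apply: (@term_while _ _ s _ _ (fun f s' => a <= ivar s' i <= N /\ I (ivar s' i) f s')).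
- move=> f' s' Fs [] /andP[ai iN] If /=; rewrite (frame_i Fs bn) sb -ltnNge addn1 ltnS => Ni.
  have {Ni iN} iN : ivar s' i = N by apply/eqP; rewrite eqn_leq iN.
  by rewrite iN in If; apply: Hout Fs If.
- move=> f' s' Fs [] /andP[ai iN] If /=; rewrite (frame_i Fs bn) sb addn1 => Ni.
  have aNi : a <= ivar s' i < N by rewrite ai.
  have [f1 [f2 [H1 H2 H3]]] := Hin _ _ _ aNi Fs erefl If.
  exists f1, f2; split=> //; apply: term_seq => //.
  apply: term_weaken H3 => // s2 F2 I2; apply: term_run => //=.
  by rewrite (frame_i F2 ip) addn1 /upd eqxx Ni leqW.
- exact: frame_refl.
- by rewrite sa leqnn.
Qed.

(** Uniform price [F0] per iteration; the strict inequality leaves one unit for the last, failing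
    test of the guard. *)
Lemma term_upto i b p s a N F0 F (I : nat -> state R -> Prop) (Q : state R -> Prop) :
  i \notin imods p -> b \notin imods p -> b != i ->
  ivar s i = a -> ivar s b = N -> a <= N -> 0 < F0 -> (N - a) * F0 < F -> I a s ->
  (forall s', frame (Upto i b p) s s' -> I N s' -> Q s') ->
  (forall j s', a <= j < N -> frame (Upto i b p) s s' -> ivar s' i = j ->
     I j s' -> term p s' F0 (fun s2 => I j.+1 (set_ivar s2 i j.+1))) ->
  term (Upto i b p) s F Q.
Proof.
move=> ip bp bi sa sb aN F0p NF I0 Hout Hin.
apply: (@term_weaken _ _ ((N - a) * F0 + 1) _ Q) => //; first by lia.
apply: (@term_upto_credit _ _ _ _ _ a N (fun j f s => f = (N - j) * F0 + 1 /\ I j s)) => //.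
  by move=> f s' Fs [-> IN]; split; [lia | apply: Hout].
move=> j f s' jN Fs sj [-> Ij]; exists F0, ((N - j.+1) * F0 + 1); split=> //.
  by rewrite addnA -mulSn subnSK //; case/andP: jN.
by apply: term_weaken (Hin _ _ jN Fs sj Ij).
Qed.

Lemma term_for i b p s N F0 F (I : nat -> state R -> Prop) (Q : state R -> Prop) :
  i \notin imods p -> b \notin imods p -> b != i ->
  ivar s b = N -> 0 < F0 -> N * F0 < F -> I 0 (set_ivar s i 0) ->
  (forall s', frame (For i b p) s s' -> I N s' -> Q s') ->
  (forall j s', j < N -> frame (For i b p) s s' -> ivar s' i = j ->
     I j s' -> term p s' F0 (fun s2 => I j.+1 (set_ivar s2 i j.+1))) ->
  term (For i b p) s F Q.
Proof.
move=> ip bp bi sb F0p NF I0 Hout Hin.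
have Fp : 0 < F by case: F NF.
have F1 : frame (For i b p) s (set_ivar s i 0).
  by apply: (@frame_mono (ISet i (ICst 0))) => //=;
    [move=> x; rewrite !inE => ->|have [T E _] := @exec_run (ISet i (ICst 0)) s isT;
     exact: frame_exec E].
have FU s' : frame (Upto i b p) (set_ivar s i 0) s' -> frame (For i b p) s s'.
  move=> Fs; apply: frame_trans F1 _; apply: frame_mono Fs => //= x xP.
  by rewrite inE xP orbT.
apply: term_seq => //; apply: term_run => //=.
apply: (@term_upto _ _ _ _ 0 N F0 _ I) => //.
- by rewrite /= /upd eqxx.
- by rewrite /= /upd (negbTE bi).
- by rewrite subn0.
- by move=> s' Fs; apply: Hout; apply: FU.
- by move=> j s' /andP[_ jN] Fs; apply: Hin => //; apply: FU.
Qed.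

End Logic.

(** * Walks, and one round of the dynamic program *)

Ltac case_min :=
  match goal with |- context [Order.min ?x ?y] => case: (lerP x y) end.

Section Walks.
Local Open Scope ring_scope.
Variables (R : realFieldType) (G : instance R).
Implicit Types (p q r : location G) (c : R).

Lemma walk_cat p q r a b : walk p q a -> walk q r b -> walk p r (a + b).
Proof.
elim=> [{}p|e x y {}q c x01 y01 _ IH] H; first by rewrite add0r.
by rewrite -addrA; apply: walk_move => //; apply: IH.
Qed.

Lemma walk_segment (e : 'I_(nE G)) (x y : R) : 0 <= x <= 1 -> 0 <= y <= 1 ->
  walk (point e x) (point e y) (`|y - x| * weight e).
Proof. by move=> x01 y01; rewrite -[_ * _]addr0; apply: walk_move => //; constructor. Qed.

Lemma walk_rev p q c : walk p q c -> walk q p c.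
Proof.
elim=> [{}p|e x y {}q a x01 y01 _ IH]; first by constructor.
by rewrite addrC distrC; apply: walk_cat IH _; apply: walk_segment.
Qed.

Lemma walk_ge0 p q c : walk p q c -> 0 <= c.
Proof. by elim=> // e x y {}q a _ _ _ IH; rewrite addr_ge0 ?mulr_ge0 ?weight_ge0. Qed.

Lemma point0 (e : 'I_(nE G)) : point e 0 = AtVertex (ends e).1.
Proof. by rewrite /point eqxx. Qed.

Lemma point1 (e : 'I_(nE G)) : point e 1 = AtVertex (ends e).2.
Proof. by rewrite /point oner_eq0 eqxx. Qed.

Definition valid p : bool := if p is Inside e x then 0 < x < 1 else true.

Lemma pointI (e : 'I_(nE G)) (x : R) : 0 < x < 1 -> point e x = Inside e x.
Proof. by case/andP=> x0 x1; rewrite /point gt_eqF // lt_eqF. Qed.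

Lemma valid_point (e : 'I_(nE G)) (x : R) : 0 <= x <= 1 -> valid (point e x).
Proof.
case/andP=> x0 x1; rewrite /point; case: eqP => //= /eqP x0'; case: eqP => //= /eqP x1'.
by rewrite !lt_neqAle x0 x1 x1' eq_sym x0'.
Qed.

Lemma point_inv (e e' : 'I_(nE G)) (x x' : R) : point e x = Inside e' x' -> e = e' /\ x = x'.
Proof. by rewrite /point; case: ifP => // _; case: ifP => // _ [-> ->]. Qed.

Lemma walk_valid p q c : walk p q c -> valid p -> valid q.
Proof. by elim=> // e x y {}q a x01 y01 _ IH _; apply: IH; apply: valid_point. Qed.

(** A move changes edge only at a vertex, so a walk that meets no vertex stays inside one edge,
    where the triangle inequality bounds its length from below. This splits every carry into two
    manageable cases. *)
Lemma walk_through p q c : walk p q c -> valid p ->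
  (exists e x y, [/\ 0 < x < 1, 0 < y < 1, p = Inside e x, q = Inside e y &
     `|y - x| * weight e <= c]) \/
  (exists u c1 c2, [/\ walk p (AtVertex u) c1, walk (AtVertex u) q c2 & c1 + c2 = c]).
Proof.
elim=> [[u|e x]|e x y {}q a x01 y01 W IH] vp.
- by right; exists u, 0, 0; split; [constructor|constructor|rewrite addr0].
- by left; exists e, x, x; split=> //; rewrite subrr normr0 mul0r.
have S := walk_segment e x01 y01.
have [|[e' [x' [y' [x'01 y'01 Ey Eq le_a]]]]|[u [c1 [c2 [W1 W2 <-]]]]] := IH.
- exact: valid_point.
- case Ex: (point e x) => [u|e0 x0].
    rewrite -Ex; right; exists u, 0, (`|y - x| * weight e + a).
    by split; [rewrite Ex; constructor|rewrite -Ex; apply: walk_cat S W|rewrite add0r].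
  have [? ?] := point_inv Ex; subst e0 x0.
  have xI : 0 < x < 1 by have := valid_point e x01; rewrite Ex.
  have [? ?] := point_inv Ey; subst e' y; rewrite pointI // in Ex *.
  left; exists e, x, y'; split=> //.
  have -> : y' - x = (y' - x') + (x' - x) by rewrite addrA subrK.
  apply: le_trans (ler_wpM2r (weight_ge0 e) (ler_normD _ _)) _.
  by rewrite mulrDl [leRHS]addrC lerD2r.
- by right; exists u, (`|y - x| * weight e + c1), c2; split=> //;
    [apply: walk_cat S W1|rewrite addrA].
Qed.

(** A dart is an edge with an orientation; [dpoint d z] lies at fraction [z]
    from its tail. *)
Notation dart := ('I_(nE G) * bool)%type.
Implicit Types d : dart.

Definition dtail d := if d.2 then (ends d.1).1 else (ends d.1).2.
Definition dhead d := if d.2 then (ends d.1).2 else (ends d.1).1.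
Definition dpoint d (z : R) := point d.1 (if d.2 then z else 1 - z).

Lemma dpoint0 d : dpoint d 0 = AtVertex (dtail d).
Proof. by case: d => e []; rewrite /dpoint /dtail /= ?subr0 ?point0 ?point1. Qed.

Lemma dpoint1 d : dpoint d 1 = AtVertex (dhead d).
Proof. by case: d => e []; rewrite /dpoint /dhead /= ?subrr ?point0 ?point1. Qed.

Lemma flip01 (b : bool) (z : R) : 0 <= z <= 1 -> 0 <= (if b then z else 1 - z) <= 1.
Proof. by case: b => //; rewrite subr_ge0 lerBlDr lerDl andbC. Qed.

Lemma walk_dart d (x y : R) : 0 <= x <= 1 -> 0 <= y <= 1 ->
  walk (dpoint d x) (dpoint d y) (`|y - x| * weight d.1).
Proof.
move=> x01 y01; case: d => e [] /=; first exact: walk_segment.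
have -> : `|y - x| = `|(1 - y) - (1 - x)| by rewrite distrC; congr `|_|; lra.
by apply: walk_segment; rewrite subr_ge0 lerBlDr lerDl andbC.
Qed.

Lemma walk_from_tail d (z : R) : 0 <= z <= 1 ->
  walk (AtVertex (dtail d)) (dpoint d z) (z * weight d.1).
Proof.
move=> z01; rewrite -dpoint0 -{2}(ger0_norm (andP z01).1) -{2}[z]subr0.
by apply: walk_dart => //; rewrite lexx ler01.
Qed.

Lemma walk_from_head d (z : R) : 0 <= z <= 1 ->
  walk (AtVertex (dhead d)) (dpoint d z) ((1 - z) * weight d.1).
Proof.
move=> z01; have [_ z1] := andP z01; rewrite -dpoint1.
rewrite -(ger0_norm (_ : 0 <= 1 - z)) ?subr_ge0 // distrC.
by apply: walk_dart => //; rewrite lexx ler01.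
Qed.

(** * Distances from the vertices of the component *)

Section Distances.
Variables (con : nat -> bool) (D : nat -> nat -> R).
Notation V := (@AtVertex R G).

Hypothesis con_walk : forall u : 'I_(nV G), con u -> exists c, walk (V (source G)) (V u) c.
Hypothesis con_closed : forall (u : 'I_(nV G)) c, walk (V (source G)) (V u) c -> con u.
(** The table is pinned down by a certificate: [D u] vanishes at [u] and is a potential along darts,
    so no walk is shorter; and it is the length of some walk, so it is attained. *)
Hypothesis D0 : forall u : 'I_(nV G), con u -> D u u = 0.
Hypothesis D_dart : forall (u : 'I_(nV G)) d, con u ->
  D u (dhead d) <= D u (dtail d) + weight d.1.
Hypothesis D_walk : forall u v : 'I_(nV G), con u -> con v -> walk (V u) (V v) (D u v).

Lemma con_trans (u v : 'I_(nV G)) c : con u -> walk (V u) (V v) c -> con v.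
Proof. by case/con_walk=> b Wb Wc; apply: con_closed (walk_cat Wb Wc). Qed.

Lemma con_head d : con (dtail d) -> con (dhead d).
Proof.
move/con_trans; apply; rewrite -dpoint1; apply: walk_from_tail.
by rewrite lexx ler01.
Qed.

Definition dist (u : nat) (p : location G) : R :=
  match p with
  | AtVertex v => D u v
  | Inside e x => Num.min (D u (ends e).1 + x * weight e) (D u (ends e).2 + (1 - x) * weight e)
  end.

(** At [x = 0] and [x = 1] the minimum collapses to a table entry, since [D_dart] for both
    orientations bounds the difference between the two ends by the weight. *)
Lemma dist_point (u : 'I_(nV G)) e (x : R) : con u -> dist u (point e x) =
  Num.min (D u (ends e).1 + x * weight e) (D u (ends e).2 + (1 - x) * weight e).
Proof.
move=> cu; have := D_dart (e, true) cu; have := D_dart (e, false) cu.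
rewrite /dhead /dtail /= => H1 H2; rewrite /point.
case: eqP => [->|_]; first by case_min; move=> /=; lra.
by case: eqP => [->|_] //=; case_min; lra.
Qed.

Lemma dist_dpoint (u : 'I_(nV G)) d (z : R) : con u -> dist u (dpoint d z) =
  Num.min (D u (dtail d) + z * weight d.1) (D u (dhead d) + (1 - z) * weight d.1).
Proof.
move=> cu; rewrite /dpoint dist_point //; case: d => e [] //=.
by rewrite /dtail /dhead /= minC opprB addrA [1 + z]addrC addrK.
Qed.

(** During one move both terms of the minimum change by at most the distance travelled. *)
Lemma dist_walk (u : 'I_(nV G)) p q c : con u -> walk p q c -> dist u q <= dist u p + c.
Proof.
move=> cu; elim=> [{}p|e x y {}q a x01 y01 _ IH]; first by rewrite addr0.
apply: le_trans IH _; rewrite addrA lerD2r !dist_point //.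
have w0 := weight_ge0 e; have Hyx : (y - x) * weight e <= `|y - x| * weight e.
  by rewrite ler_wpM2r // ler_norm.
have Hxy : (x - y) * weight e <= `|y - x| * weight e.
  by rewrite distrC ler_wpM2r // ler_norm.
by case_min; move=> ?; case_min; move=> ?; lra.
Qed.

Lemma dist_le (u : 'I_(nV G)) q c : con u -> walk (V u) q c -> dist u q <= c.
Proof. by move=> cu /(dist_walk cu) /=; rewrite D0 // add0r. Qed.

Lemma dist_le_rev (u : 'I_(nV G)) q c : con u -> walk q (V u) c -> dist u q <= c.
Proof. by move=> cu /walk_rev; apply: dist_le. Qed.

Lemma D_symm (u v : 'I_(nV G)) : con u -> con v -> D u v = D v u.
Proof.
move=> cu cv; apply/eqP; rewrite eq_le.
by apply/andP; split; [apply: (@dist_le_rev u (V v))|apply: (@dist_le_rev v (V u))] => //;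
  apply: D_walk.
Qed.

Lemma walk_dist_dpoint (u : 'I_(nV G)) d (z : R) : con u -> con (dtail d) -> 0 <= z <= 1 ->
  walk (dpoint d z) (V u) (dist u (dpoint d z)).
Proof.
move=> cu ct z01; rewrite dist_dpoint //; apply: walk_rev; case_min; move=> _.
  by apply: walk_cat (D_walk cu ct) _; apply: walk_from_tail.
by apply: walk_cat (D_walk cu (con_head ct)) _; apply: walk_from_head.
Qed.

(** One round of the dynamic program: agent [i], which starts at a vertex [h]
    of the component of the source, moves after those of [l]. *)
Section Round.
Variables (vers : version) (i : 'I_(nA G)) (l : seq 'I_(nA G)).
Variables (M : nat) (lab : 'I_M -> dart).
Hypothesis lab_onto : forall d, exists j, lab j = d.
Let h := start i.
Hypothesis con_h : con h.
Notation tl j := (dtail (lab j)).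
Notation hd j := (dhead (lab j)).
Notation wt j := (weight (lab j).1).

(** After the agents of [l] have moved, [reach] is the set of the vertices where
    the message can be and [a j] is how far it can get along the dart [lab j]. *)
Definition sound (l : seq 'I_(nA G)) (reach : nat -> bool) (a : nat -> R) :=
  [/\ forall u : 'I_(nV G), reach u -> handover vers l (V (source G)) (V u),
      forall j : 'I_M, reach (tl j) -> exists z, [/\ 0 <= z <= 1, z * wt j = a j &
        handover vers l (V (source G)) (dpoint (lab j) z)],
      forall u : 'I_(nV G), reach u -> con u &
      forall j : 'I_M, con (tl j) -> 0 <= a j /\ (~~ reach (tl j) -> a j = 0)].

(** An upper bound for the reachable places: a point short of the farthest point is covered without
    any claim that the message can be left there. *)
Definition covered (reach : nat -> bool) (a : nat -> R) (q : location G) : Prop :=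
  match q with
  | AtVertex v => reach v
  | Inside e x => exists (j : 'I_M) z, [/\ reach (tl j), 0 <= z <= 1,
      dpoint (lab j) z = Inside e x & z * wt j <= a j]
  end.

Definition complete (l : seq 'I_(nA G)) (reach : nat -> bool) (a : nat -> R) :=
  forall q, handover vers l (V (source G)) q -> covered reach a q.

Definition retcost (q : location G) : R := if vers is Returning then dist h q else 0.

(** The same cost at distance [y] from the tail of the dart [lab j]. *)
Definition dretcost (j : 'I_M) (y : R) : R :=
  if vers is Returning then Num.min (D h (tl j) + y) (D h (hd j) + wt j - y) else 0.

Lemma retcost_dpoint j z : retcost (dpoint (lab j) z) = dretcost j (z * wt j).
Proof.
rewrite /retcost /dretcost; case: vers => //; rewrite dist_dpoint //.
by congr (Num.min _ _); lra.
Qed.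

Lemma can_carryI p q b c : walk (V h) p b -> walk p q c -> walk q (V h) (retcost q) \/ vers = NonReturning ->
  b + c + retcost q <= budget i -> can_carry vers i p q.
Proof.
move=> W1 W2; rewrite /can_carry /retcost; case: vers => [[W3|//]|_] le_b.
  by exists b, c, (dist h q).
by exists b, c; split=> //; rewrite addr0 in le_b.
Qed.

Lemma can_carryE p q : can_carry vers i p q -> exists b c,
  [/\ walk (V h) p b, walk p q c & b + c + retcost q <= budget i].
Proof.
rewrite /can_carry /retcost; case: vers => [[b [c [r [W1 W2 W3 le_b]]]]|[b [c [W1 W2 le_b]]]].
  by exists b, c; split=> //; apply: le_trans le_b; rewrite lerD2l; apply: dist_le_rev.
by exists b, c; split=> //; rewrite addr0.
Qed.

Variables (reach : nat -> bool) (a c : nat -> R).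
Hypothesis reach_sound : sound l reach a.

(** [c u] is the least energy that [i] needs to bring the message to [u]: the
    agent may pick it up at the first place of the explored region on its way,
    either a vertex, or the farthest point of a dart entered from its head. *)
Hypothesis c_le_vertex : forall u v : 'I_(nV G), con u -> reach v ->
  c u <= D h v + D v u.
Hypothesis c_le_dart : forall (u : 'I_(nV G)) (j : 'I_M), con u -> reach (tl j) ->
  c u <= D h (hd j) + (wt j - a j) + (wt j - a j) + D (hd j) u.
Hypothesis c_attained : forall u : 'I_(nV G), con u ->
  (exists v : 'I_(nV G), reach v /\ c u = D h v + D v u) \/
  (exists j : 'I_M, reach (tl j) /\
     c u = D h (hd j) + (wt j - a j) + (wt j - a j) + D (hd j) u).

(** In the dart case the agent goes in by the head, takes the message at the farthest point and
    leaves by the head again; hence [wt j - a j] occurs twice. *)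
Lemma c_walk (u : 'I_(nV G)) : con u -> exists p b b',
  [/\ handover vers l (V (source G)) p, walk (V h) p b, walk p (V u) b' & b + b' <= c u].
Proof.
have [Hr Hf Hc Ha] := reach_sound => cu.
have [[v [rv ->]]|[j [rj ->]]] := c_attained cu.
  exists (V v), (D h v), (D v u); split=> //; [exact: Hr | |]; apply: D_walk => //; exact: Hc.
have [z [z01 Ez Hz]] := Hf j rj; have ct := Hc _ rj; have ch := con_head ct.
exists (dpoint (lab j) z), (D h (hd j) + (1 - z) * wt j), ((1 - z) * wt j + D (hd j) u).
split=> //.
- by apply: walk_cat (D_walk con_h ch) _; apply: walk_from_head.
- by apply: walk_cat (D_walk ch cu); apply: walk_rev; apply: walk_from_head.
- by rewrite -Ez; lra.
Qed.

(** Shortest routes to and from [p] each use one end of the dart. If either uses the tail, a pick-up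
    at the tail, which is reached, costs no more. If both use the head, each covers at least
    [wt j - a j], because [p] is no farther than the farthest point. *)
Lemma c_le_walk p (u : 'I_(nV G)) b b' : con u -> covered reach a p ->
  walk (V h) p b -> walk p (V u) b' -> c u <= b + b'.
Proof.
have [Hr Hf Hc Ha] := reach_sound => cu.
case: p => [v rv|e x [j [z [rj z01 <- le_a]]]] W1 W2.
  have cv := Hc _ rv; apply: le_trans (c_le_vertex cu rv) _.
  by apply: lerD; [apply: dist_le W1|apply: (@dist_le v (V u)) => //].
have ct := Hc _ rj; have ch := con_head ct.
have := dist_le con_h W1; have := dist_le_rev cu W2; rewrite !dist_dpoint //.
rewrite [D u (tl j)]D_symm // [D u (hd j)]D_symm // => H2 H1.
have Ht := c_le_vertex cu rj; have Hh := c_le_dart cu rj.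
have w0 := weight_ge0 (lab j).1.
have [z0 z1] := andP z01; have zw : z * wt j <= wt j by rewrite ler_piMl.
have zw0 : 0 <= z * wt j by rewrite mulr_ge0.
have Ds1 : D h (tl j) <= D h (hd j) + wt j.
  by have := D_dart ((lab j).1, ~~ (lab j).2) con_h; rewrite /dhead /dtail /=; case: (lab j).2.
have Ds2 : D (tl j) u <= D (hd j) u + wt j.
  rewrite [D (tl j) u]D_symm // [D (hd j) u]D_symm //.
  by have := D_dart ((lab j).1, ~~ (lab j).2) cu; rewrite /dhead /dtail /=; case: (lab j).2.
by move: H1 H2; case_min; move=> _ H1; case_min; move=> _ H2; lra.
Qed.

(** The message can be carried to distance [y] from the tail of [lab j], having
    been picked up outside of that dart or, respectively, inside of it. *)
Definition extends (j : 'I_M) (y : R) : Prop :=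
  c (tl j) + y + dretcost j y <= budget i \/
  [/\ reach (tl j), a j <= y &
      D h (hd j) + (wt j - a j) + (y - a j) + dretcost j y <= budget i].

Variables (reach' : nat -> bool) (a' : nat -> R).
Hypothesis reach'E : forall u : 'I_(nV G),
  reach' u = reach u || con u && (c u + retcost (V u) <= budget i).
Hypothesis a'_extends : forall j : 'I_M, con (tl j) ->
  a' j = a j \/ 0 <= a' j <= wt j /\ extends j (a' j).
Hypothesis a'_max : forall j : 'I_M, con (tl j) ->
  a j <= a' j /\ forall y, 0 <= y <= wt j -> extends j y -> y <= a' j.

(** The return cost changes by at most [y] over a stretch of length [y], so an agent able to carry
    the message that far could also have stopped at the tail. *)
Lemma extends_reach' j y : con (tl j) -> 0 <= y <= wt j -> extends j y -> reach' (tl j).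
Proof.
move=> ct /andP[y0 yw] [le_b|[rj _ _]]; rewrite reach'E ?rj // ct.
apply/orP; right; apply: le_trans le_b; rewrite -addrA lerD2l addrC.
rewrite -[V _]dpoint0 retcost_dpoint mul0r.
move: y0 yw; rewrite /dretcost; case: vers; last by rewrite add0r.
by move=> ? ?; case_min; move=> ?; case_min; move=> ?; lra.
Qed.

(** [handover] peels off the first agent, whereas a round appends the last one. *)
Lemma handover_rcons v (k : 'I_(nA G)) m p q r : handover v m p q ->
  can_carry v k q r -> handover v (rcons m k) p r.
Proof.
elim=> [{}p|k' m' {}p {}q _ IH|k' m' {}p q' {}q Hc _ IH] H /=.
- by apply: handover_carry H _; constructor.
- by apply: handover_idle; apply: IH.
- by apply: handover_carry Hc _; apply: IH.
Qed.

Lemma handover_rcons_idle v (k : 'I_(nA G)) m p q :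
  handover v m p q -> handover v (rcons m k) p q.
Proof.
elim=> [{}p|k' m' {}p {}q _ IH|k' m' {}p q' {}q Hc _ IH] /=.
- by apply: handover_idle; constructor.
- by apply: handover_idle.
- by apply: handover_carry Hc _.
Qed.

Lemma handover_rconsE v (k : 'I_(nA G)) m p r : handover v (rcons m k) p r ->
  handover v m p r \/ exists2 q, handover v m p q & can_carry v k q r.
Proof.
elim: m p => [|k' m IH] p /= H.
  inversion H as [|? ? ? ? H1|? ? ? q ? Hc H1]; subst; inversion H1; subst.
    by left; constructor.
  by right; exists p => //; constructor.
inversion H as [|? ? ? ? H1|? ? ? q ? Hc H1]; subst; case/IH: H1 => [H1|[q' H1 H2]].
- by left; apply: handover_idle.
- by right; exists q' => //; apply: handover_idle.
- by left; apply: handover_carry Hc H1.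
- by right; exists q' => //; apply: handover_carry Hc H1.
Qed.

Lemma can_carry_valid v k p q : valid p -> can_carry v k p q -> valid q.
Proof.
move=> vp; case: v => /= [[b [c' [c'' [_ W _ _]]]]|[b [c' [_ W _]]]];
  exact: walk_valid W vp.
Qed.

Lemma handover_valid v m p q : handover v m p q -> valid p -> valid q.
Proof. by elim=> // k m' {}p q' r Hc _ IH vp; apply: IH; apply: can_carry_valid Hc. Qed.

Lemma round_sound : sound (rcons l i) reach' a'.
Proof.
have [Hr Hf Hc Ha] := reach_sound.
have Hr' (u : 'I_(nV G)) : reach' u -> handover vers (rcons l i) (V (source G)) (V u).
  rewrite reach'E; case/orP=> [/Hr|/andP[cu le_b]]; first exact: handover_rcons_idle.
  have [p [b [b' [H W1 W2 le_c]]]] := c_walk cu.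
  apply: handover_rcons H _; apply: (can_carryI W1 W2); last first.
    by apply: le_trans le_b; rewrite lerD2r.
  by rewrite /retcost; case: vers; [left|right] => //=; apply: walk_rev; apply: D_walk.
have Hc' (u : 'I_(nV G)) : reach' u -> con u.
  by rewrite reach'E; case/orP=> [/Hc|/andP[]].
split=> //.
- move=> j rj; have ct := Hc' _ rj; have ch := con_head ct.
  have ret z : 0 <= z <= 1 ->
      walk (dpoint (lab j) z) (V h) (retcost (dpoint (lab j) z)) \/ vers = NonReturning.
    by rewrite /retcost; case: vers; [left|right] => //=; apply: walk_dist_dpoint.
  have w0 := weight_ge0 (lab j).1.
  have [->|[/andP[y0 yw] Hext]] := a'_extends ct.
    have [rt|nrt] := boolP (reach (tl j)).
      have [z [z01 Ez Hz]] := Hf j rt; exists z; split=> //.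
      exact: handover_rcons_idle.
    exists 0; split; first by rewrite lexx ler01.
      by rewrite mul0r; have [_ ->] := Ha j ct.
    by rewrite dpoint0; apply: Hr'.
  (* On an edge of weight 0 the energy [a' j] is 0 and does not determine the fraction; the tail is
     chosen. *)
  pose z := if wt j == 0 then 0 else a' j / wt j.
  have Ez : z * wt j = a' j.
    rewrite /z; case: eqP => [E0|/eqP E0]; last by rewrite divfK.
    by rewrite mul0r; move: yw y0; rewrite E0 => *; apply/eqP; rewrite eq_le; apply/andP.
  have z01 : 0 <= z <= 1.
    rewrite /z; case: eqP => [_|/eqP E0]; first by rewrite lexx ler01.
    have wp : 0 < wt j by rewrite lt_neqAle eq_sym E0.
    by rewrite divr_ge0 // ler_pdivrMr // mul1r.
  exists z; split=> //; case: Hext => [le_b|[rt le_a le_b]].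
    have [p [b [b' [H W1 W2 le_c]]]] := c_walk ct.
    apply: handover_rcons H _.
    apply: (can_carryI W1 (walk_cat W2 (walk_from_tail _ z01)) (ret z z01)).
    rewrite retcost_dpoint Ez; apply: le_trans le_b; rewrite addrA !lerD2r.
    exact: le_c.
  (* The message waits at the old farthest point; the agent comes from the head and carries it back
     towards the head. *)
  have [z0 [z001 Ez0 Hz0]] := Hf j rt.
  apply: handover_rcons Hz0 _.
  have W1 := walk_cat (D_walk con_h ch) (walk_from_head (lab j) z001).
  apply: (can_carryI W1 (walk_dart (lab j) z001 z01) (ret z z01)).
  rewrite retcost_dpoint Ez; apply: le_trans le_b; rewrite lerD2r.
  have -> : `|z - z0| * wt j = a' j - a j.
    by rewrite -[X in _ * X](ger0_norm w0) -normrM mulrBl Ez Ez0 ger0_norm ?subr_ge0.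
  by rewrite mulrBl Ez0 mul1r.
- move=> j ct; have [a0 anr] := Ha j ct; have [aa _] := a'_max ct.
  split=> [|nr']; first exact: le_trans aa.
  have [->|[y01 Hext]] := a'_extends ct.
    by apply: anr; apply: contra nr'; rewrite reach'E => ->.
  by rewrite (extends_reach' ct y01 Hext) in nr'.
Qed.

(** A carry through a vertex enters its last edge by an end, so it extends the dart starting at that
    end, its first part being bounded by [c]. A carry that meets no vertex moves inside a single
    dart, already covered up to the pick-up. *)
Lemma round_complete : complete l reach a -> complete (rcons l i) reach' a'.
Proof.
have [Hr Hf Hc Ha] := reach_sound.
move=> Hcomp q Hq; have vq := handover_valid Hq isT; case/handover_rconsE: Hq => [/Hcomp|[p Hp]].
  case: q vq => [v _ /= rv|e x _ /= [j [z [rj z01 Ej le_a]]]]; first by rewrite reach'E rv.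
  exists j, z; split=> //; first by rewrite reach'E rj.
  by apply: le_trans le_a _; have [] := a'_max (Hc _ rj).
have vp := handover_valid Hp isT; have {Hcomp} := Hcomp _ Hp.
move=> cov /can_carryE[b [b' [W1 W2 le_b]]].
have ext (j : 'I_M) z e x : 0 <= z <= 1 -> dpoint (lab j) z = Inside e x ->
    con (tl j) -> z * wt j <= a j /\ reach (tl j) \/ extends j (z * wt j) ->
    covered reach' a' (Inside e x).
  move=> z01 Ed ct Hext; have [z0 z1] := andP z01.
  have y01 : 0 <= z * wt j <= wt j by rewrite mulr_ge0 ?ler_piMl ?weight_ge0.
  have [le_a max_a] := a'_max ct; exists j, z; case: Hext => [[le_y rj]|He]; split=> //.
  - by rewrite reach'E rj.
  - exact: le_trans le_y le_a.
  - exact: extends_reach' He.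
  - exact: max_a.
have via_vertex (u : 'I_(nV G)) c1 c2 :
    walk p (V u) c1 -> walk (V u) q c2 -> b + c1 + c2 + retcost q <= budget i ->
    covered reach' a' q.
  move=> Wp Wq le_B; have cu := con_trans con_h (walk_cat W1 Wp).
  case: q vq Wq le_B {W2 le_b} => [v _ Wq le_B|e x x01 Wq le_B].
    have cv := con_trans cu Wq; rewrite /= reach'E cv; apply/orP; right.
    apply: le_trans le_B; rewrite lerD2r -addrA.
    exact: (c_le_walk cv cov W1 (walk_cat Wp Wq)).
  have x01' : 0 <= x <= 1 by case/andP: x01 => *; rewrite !ltW.
  have via d z : 0 <= z <= 1 -> dpoint d z = Inside e x -> con (dtail d) ->
      D u (dtail d) + z * weight d.1 <= c2 -> covered reach' a' (Inside e x).
    move=> z01 Ed ct le_c2; have [j Ej] := lab_onto d; subst d; apply: (ext j z) => //; right; left.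
    rewrite -retcost_dpoint Ed; apply: le_trans le_B; rewrite lerD2r.
    have := c_le_walk ct cov W1 (walk_cat Wp (D_walk cu ct)).
    by move: le_c2; lra.
  have ct : con (ends e).1.
    by apply: con_trans cu (walk_cat Wq _); rewrite -pointI // -point0;
       apply: walk_segment => //; rewrite lexx ler01.
  have ch := @con_head (e, true) ct.
  have := dist_le cu Wq; rewrite /=; case_min; move=> _ le_c2.
    by apply: (via (e, true) x) => //; rewrite /dpoint /= pointI.
  apply: (via (e, false) (1 - x)) => //; first exact: (@flip01 false).
  by rewrite /dpoint /= subKr pointI.
have [[e [x [y [x01 y01 Ep Eq le_b']]]]|[u [c1 [c2 [Wp Wq Ec]]]]] := walk_through W2 vp; last first.
  by apply: (via_vertex u c1 c2) => //; rewrite -[b + _ + _]addrA Ec.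
move: cov; rewrite Ep Eq => -[j [z0 [rj z01 Ed le_a]]].
have ct := Hc _ rj; have ch := con_head ct; have w0 := weight_ge0 (lab j).1.
have Ee : (lab j).1 = e by have [] := point_inv Ed.
pose z := if (lab j).2 then y else 1 - y.
have y01' : 0 <= y <= 1 by case/andP: y01 => *; rewrite !ltW.
have z01' : 0 <= z <= 1 by apply: flip01.
have Ez : dpoint (lab j) z = Inside e y.
  by rewrite /dpoint /z Ee; case: (lab j).2; rewrite ?subKr pointI.
have Ezz : `|z - z0| = `|y - x|.
  have [_] := point_inv Ed; rewrite /z; case: (lab j).2 => [-> //|<-].
  by rewrite distrC; congr `|_|; lra.
apply: (ext j z) => //.
have [le_za|lt_az] := lerP (z * wt j) (a j); [by left|right].
have := dist_le con_h W1; rewrite Ep -Ed dist_dpoint // => Hb.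
have le_zz : z * wt j <= z0 * wt j + b'.
  rewrite -lerBlDl -mulrBl; apply: le_trans le_b'; rewrite -Ezz Ee.
  by rewrite ler_wpM2r ?weight_ge0 // ler_norm.
rewrite /extends -retcost_dpoint Ez -Eq.
(* If the agent came by the tail, it could have picked up there, so [c] at the tail is small enough
   for the first case of [extends]; if it came by the head, starting from the farthest point saves
   energy and gives the second. *)
move: Hb; case_min; move=> _ Hb; [left|right; split=> //; first exact: ltW].
  have := c_le_vertex ct rj; rewrite D0 //; lra.
lra.
Qed.

End Round.
End Distances.
End Walks.

(** * Shortest paths with a tournament tree *)

Notation "p ;; q" := (Seq p q) (at level 60, right associativity).
Notation "[# x ]" := (IVar x) (at level 0).
Notation "e1 :+ e2" := (IAdd e1 e2) (at level 50, left associativity).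
Notation "1#" := (ICst 1) (at level 0).
Notation "0#" := (ICst 0) (at level 0).
Notation "e1 :+: e2" := (RAdd e1 e2) (at level 50, left associativity).
Notation "e1 :-: e2" := (RSub e1 e2) (at level 50, left associativity).

(** Memory layout, indices being arrays unless stated otherwise.  Variable 5
    counts the darts; 4: first dart with a given tail (darts are sorted by tail);
    5, 6: tail and head of a dart; 7: [u * nV G], the start of row [u] of a
    square table; 8: halves; 9: is the vertex in the component of the source;
    10: has it been extracted; 11: tournament tree, with children [i + i] and
    [i + i + 1] of node [i] and leaf [nV G + u] for vertex [u]; 12: can the
    message be brought to the vertex.  Arrays of reals: 2: length of a dart;
    3: length of some walk from the source; 4: tentative distances; 5: table of
    all distances; 6: how far along a dart the message can be brought; 7: energy
    that the current agent needs to bring the message to a vertex. *)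
Notation vN := 0 (only parsing).
Notation vM := 1 (only parsing).
Notation vK := 2 (only parsing).
Notation vS := 3 (only parsing).
Notation vT := 4 (only parsing).
Notation vCnt := 5 (only parsing).
Notation gE1 := (IGet 0).
Notation gE2 := (IGet 1).
Notation gStart := (IGet 2).
Notation gTurn := (IGet 3).
Notation gOff := (IGet 4).
Notation gTl := (IGet 5).
Notation gHd := (IGet 6).
Notation gRow := (IGet 7).
Notation gHalf := (IGet 8).
Notation gCon := (IGet 9).
Notation gDone := (IGet 10).
Notation gTree := (IGet 11).
Notation gReach := (IGet 12).
Notation gW := (RGet 0).
Notation gB := (RGet 1).
Notation gWt := (RGet 2).
Notation gH := (RGet 3).
Notation gDist := (RGet 4).
Notation gD := (RGet 5).
Notation gA := (RGet 6).
Notation gC := (RGet 7).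

(** With only negation and conjunction at hand, the test says: [b] is extracted, or [a] is not and
    its key is at most that of [b]. *)
Definition pick_if (a b : iexp) : cmd :=
  If (BNot (BAnd (ILe (gDone b) 0#) (BNot (BAnd (ILe (gDone a) 0#) (RLe (gDist a) (gDist b))))))
    (IPut 11 [# 8] a) (IPut 11 [# 8] b).
Definition pick : cmd := pick_if (gTree ([# 8] :+ [# 8])) (gTree ([# 8] :+ [# 8] :+ 1#)).
Definition climb : cmd := While (ILe 1# [# 8]) (pick ;; ISet 8 (gHalf [# 8])).
Definition touch (x : nat) : cmd := ISet 8 (gHalf ([# vN] :+ [# x])) ;; climb.
Definition build : cmd :=
  ISet 8 (ISub [# vN] 1#) ;; While (ILe 1# [# 8]) (pick ;; ISet 8 (ISub [# 8] 1#)).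

Definition relax : cmd :=
  ISet 12 (gHd [# 10]) ;;
  RSet 0 (gDist [# 9] :+: gWt [# 10]) ;;
  If (RLe (gDist [# 12]) (RVar 0)) Skip (RPut 4 [# 12] (RVar 0) ;; touch 12).
Definition extract : cmd :=
  ISet 9 (gTree 1#) ;; IPut 10 [# 9] 1# ;; touch 9 ;;
  ISet 10 (gOff [# 9]) ;; ISet 11 (gOff ([# 9] :+ 1#)) ;; Upto 10 11 relax.
Definition init_row : cmd :=
  For 7 vN (RPut 4 [# 7] (gH [# 6] :+: gH [# 7]) ;; IPut 10 [# 7] 0# ;;
            IPut 11 ([# vN] :+ [# 7]) [# 7]) ;;
  RPut 4 [# 6] RZero.
Definition copy_row : cmd := For 7 vN (RPut 5 (gRow [# 6] :+ [# 7]) (gDist [# 7])).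
Definition dijkstra : cmd := init_row ;; build ;; For 7 vN extract ;; copy_row.
Definition all_pairs : cmd := For 6 vN dijkstra.

(** * The tournament tree and its repair after a change of one key *)

Section Tournament.
Variables (R : realFieldType) (n : nat).
Hypothesis n_gt0 : 0 < n.
Implicit Types (dn tr : nat -> nat) (ds : nat -> R) (st : state R).

(** Among vertices with keys [ds], those not yet extracted come first. *)
Definition better dn ds (a b : nat) : bool :=
  ~~ ((dn b <= 0) && ~~ ((dn a <= 0) && (ds a <= ds b)%R)).

Lemma better_refl dn ds a : better dn ds a a.
Proof. by rewrite /better lexx andbT andbN. Qed.

Lemma better_trans dn ds b a c : better dn ds a b -> better dn ds b c -> better dn ds a c.
Proof.
rewrite /better; case: (dn a <= 0); case: (dn b <= 0); case: (dn c <= 0) => //=.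
by rewrite !negbK; apply: le_trans.
Qed.

Lemma better_total dn ds a b : ~~ better dn ds a b -> better dn ds b a.
Proof.
rewrite /better; case: (dn a <= 0); case: (dn b <= 0) => //=.
by rewrite !negbK -ltNge; apply: ltW.
Qed.

Definition node dn ds tr (i : nat) : Prop :=
  [/\ tr i = tr (i + i) \/ tr i = tr (i + i + 1),
      better dn ds (tr i) (tr (i + i)) & better dn ds (tr i) (tr (i + i + 1))].

Definition leaves tr : Prop := forall v, v < n -> tr (n + v) = v.

Definition tree dn ds tr : Prop := leaves tr /\ forall i, 0 < i < n -> node dn ds tr i.

Definition above (x i : nat) : Prop := exists j, i = iter j half x.

Lemma iter_half_anti j x : iter j half x <= x.
Proof. by elim: j => //= j IH; apply: leq_trans IH; lia. Qed.

Lemma above_root x : 0 < x -> above x 1.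
Proof.
elim/ltn_ind: x => x IH x0; case: (leqP x 1) => [x1|x1].
  by exists 0 => /=; lia.
have [||j Ej] := IH x./2; [lia|lia|by exists j.+1; rewrite iterSr].
Qed.

(** Following the child that supplies the winner leads down to the winner's own leaf. The induction
    is on [n + n - i], which drops at each child, so [n] may be any positive number and not just a
    power of two. *)
Lemma tree_above dn ds tr i : tree dn ds tr -> 0 < i < n + n ->
  tr i < n /\ above (n + tr i) i.
Proof.
case=> lv nd; move: {2}(n + n - i) (leqnn (n + n - i)) => d.
elim: d i => [|d IH] i; first lia.
move=> id i0; have [ni|ni] := leqP n i.
  have /lv : i - n < n by lia.
  rewrite subnKC // => ->; split; first by lia.
  by exists 0 => /=; lia.
have [|H _ _] := nd i; first lia.
have key c : tr i = tr c -> c./2 = i -> i < c < n + n -> tr i < n /\ above (n + tr i) i.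
  move=> Ec ci ic; have [||H1 [j Ej]] := IH c; [lia|lia|].
  by rewrite Ec; split=> //; exists j.+1; rewrite /= -Ej.
by case: H => /key; apply; lia.
Qed.

Lemma tree_root dn ds tr : tree dn ds tr ->
  tr 1 < n /\ forall v, v < n -> better dn ds (tr 1) v.
Proof.
move=> T; split=> [|v vn]; first by have [] := tree_above (i := 1) T; first lia.
have [j Ej] : above (n + v) 1 by apply: above_root; lia.
suff H i : 0 < iter i half (n + v) -> better dn ds (tr (iter i half (n + v))) v.
  by rewrite Ej; apply: H; rewrite -Ej.
case: T => lv nd {j Ej}; elim: i => [|i IH] /=; first by rewrite lv // better_refl.
move: (iter i half (n + v)) (iter_half_anti i (n + v)) IH => x xn IH x0.
have [|_ B1 B2] := nd x./2; first by lia.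
have : better dn ds (tr x) v by apply: IH; lia.
apply: better_trans.
have [E|E] : x./2 + x./2 = x \/ x./2 + x./2 + 1 = x by lia.
  by rewrite E in B1.
by rewrite E in B2.
Qed.

Lemma pickE st i : ivar st 8 = i -> 0 < i ->
  [/\ leaves (iarr st 11) -> i < n -> leaves (iarr (run pick st) 11),
      node (iarr st 10) (rarr st 4) (iarr (run pick st) 11) i &
      forall i', i' <> i -> iarr (run pick st) 11 i' = iarr st 11 i'].
Proof.
move=> Ei i0; pose a := iarr st 11 (i + i); pose b := iarr st 11 (i + i + 1).
have E : iarr (run pick st) 11 =
    upd (iarr st 11) i (if better (iarr st 10) (rarr st 4) a b then a else b).
  by rewrite /= Ei -/a -/b /better; case: ifP.
rewrite {}E /upd; split.
- by move=> lv lin v vn; rewrite lv //; case: eqP => //; lia.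
- have [E1 E2] : (i + i == i) = false /\ (i + i + 1 == i) = false by lia.
  rewrite /node eqxx E1 E2 -/a -/b; case: ifP => B; split; rewrite ?better_refl //; [by left|by right|].
  by apply: better_total; rewrite B.
- by move=> i' /eqP/negbTE->.
Qed.

(** Only ancestors of the current node may be out of order, and each iteration repairs one. An index
    below [2 ^ L.-1] vanishes after at most [L.-1] halvings; the last unit pays for the final
    test. *)
Lemma climb_spec st L : 0 < L -> ivar st 8 < 2 ^ L.-1 -> ivar st 8 < n ->
  (forall i, i < n + n -> iarr st 8 i = i./2) -> leaves (iarr st 11) ->
  (forall i, 0 < i < n -> node (iarr st 10) (rarr st 4) (iarr st 11) i \/ above (ivar st 8) i) ->
  term climb st L (fun st' => tree (iarr st' 10) (rarr st' 4) (iarr st' 11)).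
Proof.
move=> L0 iL lin hf lv nd.
apply: (@term_while _ _ _ st st L (fun f s => [/\ 0 < f, ivar s 8 < 2 ^ f.-1, ivar s 8 < n,
  leaves (iarr s 11) & forall i, 0 < i < n -> node (iarr s 10) (rarr s 4) (iarr s 11) i
     \/ above (ivar s 8) i])) => //.
- move=> f s _ [f0 _ _ lvs nds] /=; rewrite -leqNgt leqn0 => /eqP i0; split=> //; split=> // i ii.
  have [//|[j Ej]] := nds i ii; move: Ej ii; rewrite i0 => ->.
  by rewrite (_ : iter j half 0 = 0) //; elim: j => //= j ->.
- move=> f s F [f0 iL' lin' lvs nds] /= i0.
  have [lv' ndi same] := pickE erefl i0.
  exists 1, f.-1; split=> //; first lia.
  apply: term_run => //; rewrite [run _ _]/=; set s1 := if _ then _ else _.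
  have Es1 : s1 = run pick s by [].
  have [F1 F2 F3] : [/\ ivar s1 8 = ivar s 8, iarr s1 10 = iarr s 10 & rarr s1 4 = rarr s 4].
    by rewrite /s1; case: ifP.
  have F4 : iarr s1 8 = iarr st 8.
    by rewrite -(frame_ia F (x := 8) isT) /s1; case: ifP.
  rewrite /= F1 F2 F3 F4 hf; last lia.
  have p2 : 2 ^ f.-1 = 2 * 2 ^ f.-2 by rewrite -expnS; congr (2 ^ _); case: f f0 iL' i0 {nds} => [|[|f]] //=; lia.
  have f1 : 0 < f.-1 by case: f f0 iL' i0 {nds p2} => [|[|f]] //=; lia.
  split=> //; [lia|lia|by rewrite Es1; apply: lv'|].
  move=> i ii; have [->|ni] := eqVneq i (ivar s 8); first by left; rewrite Es1.
  have [Hi|[j Ej]] := nds i ii; last first.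
    by right; case: j Ej => [|j] Ej; [move: ni; rewrite Ej eqxx|exists j; rewrite -iterSr].
  have [h|h] := eqVneq i (ivar s 8)./2; first by right; exists 0.
  by left; rewrite Es1 /node !same //; [lia|lia|apply/eqP].
Qed.

(** A node where [v] is neither the winner nor the winner of a child compares unchanged keys. By
    [tree_above] every other node lies above the leaf of [v], on the path that [climb] repairs. *)
Lemma touch_spec st x v L dn0 ds0 :
  ivar st 0 = n -> ivar st x = v -> v < n -> n <= 2 ^ L ->
  (forall i, i < n + n -> iarr st 8 i = i./2) ->
  tree dn0 ds0 (iarr st 11) ->
  (forall u, u != v -> iarr st 10 u = dn0 u /\ rarr st 4 u = ds0 u) ->
  term (touch x) st L.+1 (fun st' => tree (iarr st' 10) (rarr st' 4) (iarr st' 11)).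
Proof.
move=> sn sx vn nL hf T same; have [lv nd] := T.
apply: term_seq => //; apply: term_run => //=; rewrite sn sx hf; last lia.
apply: climb_spec => //=; rewrite /upd /=; [lia|lia|].
move=> i ii; have [H B1 B2] := nd i ii.
have up c : c < n + n -> 0 < c -> iarr st 11 c = v -> c != n + v -> above (n + v)./2 c.
  move=> cn c0 Ec cv; have [|_ [j]] := tree_above (i := c) T; first lia.
  rewrite Ec; case: j => [|j] Ej; first by move: cv; rewrite Ej eqxx.
  by exists j; rewrite -iterSr.
have up2 c : c < n + n -> 0 < c -> iarr st 11 c = v -> above (n + v)./2 c./2.
  move=> cn c0 Ec; have [->|cv] := eqVneq c (n + v); first by exists 0.
  by have [j ->] := up c cn c0 Ec cv; exists j.+1.
have [E1|N1] := eqVneq (iarr st 11 i) v.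
  by right; apply: up => //; lia.
have [E2|N2] := eqVneq (iarr st 11 (i + i)) v.
  by right; rewrite (_ : i = (i + i)./2); [apply: up2 => //|]; lia.
have [E3|N3] := eqVneq (iarr st 11 (i + i + 1)) v.
  by right; rewrite (_ : i = (i + i + 1)./2); [apply: up2 => //|]; lia.
left; split=> //; rewrite /better.
- by have [-> ->] := same _ N1; have [-> ->] := same _ N2.
- by have [-> ->] := same _ N1; have [-> ->] := same _ N3.
Qed.

Lemma build_spec st : ivar st 0 = n -> leaves (iarr st 11) ->
  term build st n (fun st' => tree (iarr st' 10) (rarr st' 4) (iarr st' 11)).
Proof.
move=> sn lv; apply: term_seq => //; apply: term_run => //=; rewrite sn.
apply: (@term_while _ _ _ (set_ivar st 8 (n - 1)) _ n (fun f s => [/\ f = (ivar s 8).+1, ivar s 8 < n,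
  leaves (iarr s 11) & forall i, ivar s 8 < i < n -> node (iarr s 10) (rarr s 4) (iarr s 11) i])) => //.
- move=> f s _ [-> _ lvs nds] /=; rewrite -leqNgt leqn0 => /eqP i0; split=> //; split=> // i ii.
  by apply: nds; rewrite i0.
- move=> f s _ [-> lin lvs nds] /= i0.
  have [lv' ndi same] := pickE erefl i0.
  exists 1, (ivar s 8); split=> //.
  apply: term_run => //; rewrite [run _ _]/=; set s1 := if _ then _ else _.
  have Es1 : s1 = run pick s by [].
  have [F1 F2 F3] : [/\ ivar s1 8 = ivar s 8, iarr s1 10 = iarr s 10 & rarr s1 4 = rarr s 4].
    by rewrite /s1; case: ifP.
  rewrite /= F1 F2 F3; rewrite /upd /=; split; [lia|lia|by rewrite Es1; apply: lv'|].
  move=> i ii; have [->|ni] := eqVneq i (ivar s 8); first by rewrite Es1.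
  by rewrite Es1 /node !same; [apply: nds; lia|lia|lia|lia].
- by rewrite /= /upd /=; split=> //; [lia|lia|move=> i; lia].
Qed.

End Tournament.

(** * Dijkstra's algorithm and its amortised cost *)

Section Dijkstra.
Variables (R : realFieldType) (n M L : nat).
Variables (off tl hd row hf : nat -> nat) (wt H : nat -> R).
Implicit Types st : state R.

Record static st : Prop := Static {
  static_n : ivar st 0 = n;
  static_M : ivar st 5 = M;
  static_off : iarr st 4 = off;
  static_tl : iarr st 5 = tl;
  static_hd : iarr st 6 = hd;
  static_row : iarr st 7 = row;
  static_half : iarr st 8 = hf;
  static_wt : rarr st 2 = wt;
  static_H : rarr st 3 = H }.

Lemma static_frame p st st' : frame p st st' ->
  [&& all (fun x => x \notin imods p) [:: 0; 5],
      all (fun x => x \notin iamods p) [:: 4; 5; 6; 7; 8] &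
      all (fun x => x \notin ramods p) [:: 2; 3]] -> static st -> static st'.
Proof.
move=> F /and3P[/and3P[i0 i5 _] /and5P[a4 a5 a6 a7 /andP[a8 _]] /and3P[r2 r3 _]] [*].
by split; rewrite ?(frame_i F) ?(frame_ia F) ?(frame_ra F).
Qed.

Hypothesis n_gt0 : 0 < n.
Hypothesis n_le : n <= 2 ^ L.
Hypothesis hfE : forall i, i < n + n -> hf i = i./2.
Hypothesis rowE : forall u, u < n -> row u = u * n.
Hypothesis off_mono : forall u, u < n -> off u <= off u.+1.
Hypothesis off0 : off 0 = 0.
Hypothesis offn : off n = M.
Hypothesis tl_lt : forall j, j < M -> tl j < n.
Hypothesis hd_lt : forall j, j < M -> hd j < n.
Hypothesis off_tl : forall j, j < M -> off (tl j) <= j < off (tl j).+1.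
Hypothesis off_tl' : forall u j, u < n -> off u <= j < off u.+1 -> j < M /\ tl j = u.
Hypothesis wt_ge0 : forall j, j < M -> (0 <= wt j)%R.

Section Source.
Variables (src : nat) (P : nat -> R -> Prop).
Hypothesis src_lt : src < n.
Hypothesis P_step : forall j x, j < M -> P (tl j) x -> P (hd j) (x + wt j)%R.

(** Dijkstra's invariant without reference to true distances: [P] says that a key is a realised
    length, and once all vertices are extracted [d_relaxed] makes the keys a potential. *)
Record dinv st : Prop := Dinv {
  d_tree : tree n (iarr st 10) (rarr st 4) (iarr st 11);
  d_order : forall u v, u < n -> v < n -> 0 < iarr st 10 u -> iarr st 10 v = 0 ->
    (rarr st 4 u <= rarr st 4 v)%R;
  d_relaxed : forall j, j < M -> 0 < iarr st 10 (tl j) ->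
    (rarr st 4 (hd j) <= rarr st 4 (tl j) + wt j)%R;
  d_valid : forall v, v < n -> P v (rarr st 4 v);
  d_src : (rarr st 4 src <= 0)%R }.

Definition deg u := off u.+1 - off u.

(** All extracted keys are at most the key of [u], so with non-negative weights a strict improvement
    can only hit a vertex not yet extracted. The tree is repaired once for [u] and at most once per
    dart leaving it. *)
Lemma extract_spec st v : static st -> dinv st -> v < n -> iarr st 10 v = 0 ->
  exists2 u, u < n /\ iarr st 10 u = 0 & term extract st (L.+2 + deg u * L.+1)
    (fun st' => dinv st' /\ iarr st' 10 = upd (iarr st 10) u 1).
Proof.
move=> S D vn v0; set u := iarr st 11 1.
set dn1 := upd (iarr st 10) u 1; set ds1 := rarr st 4.
have [un root] := tree_root n_gt0 (d_tree D); rewrite -/u in un root.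
have [u0 umin] : iarr st 10 u = 0 /\ forall x, x < n -> iarr st 10 x = 0 -> (ds1 u <= ds1 x)%R.
  have key x : x < n -> iarr st 10 x = 0 -> iarr st 10 u = 0 /\ (ds1 u <= ds1 x)%R.
    move=> xn x0; have := root x xn; rewrite /better x0 leqnn /= negbK leqn0.
    by case/andP=> /eqP.
  by have [u0 _] := key v vn v0; split=> // x xn x0; have [] := key x xn x0.
exists u => //; rewrite /extract.
do 2 (apply: term_seq => //; apply: term_run => //=).
apply: term_seq => //; set st1 := set_iarr _ _ _ _.
have S1 : static st1 by case: S.
apply: (@term_weaken _ _ _ (L.+1) _ (fun st' => tree n (iarr st' 10) (rarr st' 4) (iarr st' 11))).
- by lia.
- move=> st2 F2 T2; have S2 := static_frame F2 isT S1.
  have dn2 : iarr st2 10 = dn1 by rewrite (frame_ia F2 (x := 10) isT).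
  have ds2 : rarr st2 4 = ds1 by rewrite (frame_ra F2 (x := 4) isT).
  have v9 : ivar st2 9 = u by rewrite (frame_i F2 (x := 9) isT).
  apply: term_seq => //; apply: term_run => //=; rewrite v9.
  apply: term_seq => //; apply: term_run => //=; rewrite v9 (static_off S2) addn1.
  set st3 := set_ivar _ _ _.
  have S3 : static st3 by case: S2.
  have [dn3 ds3 v93] : [/\ iarr st3 10 = dn1, rarr st3 4 = ds1 & ivar st3 9 = u] by [].
  pose J j s := [/\ tree n (iarr s 10) (rarr s 4) (iarr s 11),
    forall x, 0 < dn1 x -> rarr s 4 x = ds1 x,
    forall x, x < n -> (rarr s 4 x <= ds1 x)%R /\ (dn1 x = 0 -> (ds1 u <= rarr s 4 x)%R),
    forall j', off u <= j' < j -> (rarr s 4 (hd j') <= ds1 u + wt j')%R &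
    forall x, x < n -> P x (rarr s 4 x)].
  have dn1u : dn1 u = 1 by rewrite /dn1 /= eqxx.
  have dn1x x : x != u -> dn1 x = iarr st 10 x by move=> xu; rewrite /dn1 /= (negbTE xu).
  have dn1_0 x : dn1 x = 0 -> iarr st 10 x = 0.
    by have [->|xu] := eqVneq x u; [rewrite dn1u|rewrite dn1x].
  have ord1 x : x < n -> 0 < dn1 x -> (ds1 x <= ds1 u)%R.
    move=> xn; have [->|xu] := eqVneq x u; first by rewrite lexx.
    by rewrite dn1x // => x0; apply: (d_order D).
  apply: (@term_upto _ 10 11 relax st3 (off u) (off u.+1) L.+1 _ J) => //.
  + exact: off_mono.
  + by rewrite -/(deg u); lia.
  + split=> //; rewrite ?ds3 //.
    - by move=> x xn; split=> // /dn1_0; apply: umin.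
    - by move=> j'; lia.
    - exact: (d_valid D).
  + move=> s F [Js1 Js2 Js3 Js4 Js5].
    have dns : iarr s 10 = dn1 by rewrite (frame_ia F (x := 10) isT).
    split=> //; split=> //.
    - move=> x y xn yn; rewrite dns => x0 y0; rewrite Js2 //.
      by apply: le_trans (ord1 _ xn x0) _; apply: (Js3 _ yn).2.
    - move=> j jM; rewrite dns => t0; rewrite (Js2 (tl j)) //.
      have [E|tu] := eqVneq (tl j) u.
        by rewrite E; apply: Js4; rewrite -E; apply: off_tl.
      apply: le_trans (Js3 _ (hd_lt jM)).1 _; apply: (d_relaxed D) => //.
      by rewrite -dn1x.
    - by apply: le_trans (d_src D); apply: (Js3 _ _).1.
  move=> j s uj F vj [Js1 Js2 Js3 Js4 Js5].
  have Ss := static_frame F isT S3.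
  have dns : iarr s 10 = dn1 by rewrite (frame_ia F (x := 10) isT).
  have v9s : ivar s 9 = u by rewrite (frame_i F (x := 9) isT).
  have [jM tj] : j < M /\ tl j = u by exact: off_tl'.
  have hn := hd_lt jM; have su : rarr s 4 u = ds1 u by rewrite Js2 ?dn1u.
  have w0 := wt_ge0 jM.
  rewrite /relax; apply: term_seq => //; apply: term_run => //=.
  apply: term_seq => //; apply: term_run => //=.
  rewrite vj v9s (static_hd Ss) (static_wt Ss) su.
  apply: term_if => //= [le_d|gt_d].
    apply: term_run => //; split=> //= j' /andP[uj'].
    by rewrite ltnS leq_eqVlt => /predU1P[->//|j'j]; apply: Js4; rewrite uj'.
  have hd0 : dn1 (hd j) = 0.
    apply/eqP; rewrite -leqn0 leqNgt; apply: contra gt_d => h0.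
    by rewrite Js2 //; apply: le_trans (ord1 _ hn h0) _; rewrite lerDl.
  apply: term_seq => //; apply: term_run => //=.
  set s3 := set_rarr _ _ _ _.
  have T3 : term (touch 12) s3 L.+1 (fun st' => tree n (iarr st' 10) (rarr st' 4) (iarr st' 11)).
    apply: (touch_spec (st := s3) (v := hd j) n_gt0 _ _ _ n_le _ Js1) => //=.
    - exact: (static_n Ss).
    - by rewrite (static_half Ss).
    - by move=> x /negbTE->.
  apply: term_weaken T3 => // s4 F4 T4.
  have ds4 x : rarr s4 4 x = if x == hd j then (ds1 u + wt j)%R else rarr s 4 x.
    by rewrite (frame_ra F4 (x := 4) isT).
  split=> //=.
  + move=> x x0; rewrite ds4; case: eqP => [E|_]; last exact: Js2.
    by rewrite E hd0 in x0.
  + move=> x xn; rewrite ds4; case: eqP => [E|_]; last exact: Js3.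
    split; last by rewrite lerDl.
    by apply: le_trans (Js3 _ xn).1; rewrite E ltW // ltNge.
  + move=> j' /andP[uj']; rewrite ltnS leq_eqVlt ds4 => /predU1P[->|j'j]; first by rewrite eqxx.
    case: eqP => [E|_]; last by apply: Js4; rewrite uj'.
    apply: le_trans (_ : rarr s 4 (hd j') <= _)%R; last by apply: Js4; rewrite uj'.
    by rewrite E ltW // ltNge.
  + move=> x xn; rewrite ds4; case: eqP => [->|_]; last exact: Js5.
    by apply: P_step => //; rewrite tj -su; apply: Js5.
- apply: (touch_spec (st := st1) (v := u) n_gt0 _ _ _ n_le _ (d_tree D)) => //=.
  + exact: (static_n S).
  + by rewrite (static_half S).
  + by move=> x /negbTE->.
Qed.

Definition row_ok (d : nat -> R) : Prop :=
  [/\ (d src <= 0)%R, forall v, v < n -> P v (d v) &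
      forall j, j < M -> (d (hd j) <= d (tl j) + wt j)%R].

(** Extraction of [u] releases the share of [u]. With [F] constantly 1 this counts the vertices
    left, with [F] the price of an extraction it is the amortised credit. *)
Lemma sum_undone (F dn : nat -> nat) u : u < n -> dn u = 0 ->
  \sum_(v <- iota 0 n | dn v == 0) F v =
  F u + \sum_(v <- iota 0 n | upd dn u 1 v == 0) F v.
Proof.
move=> un u0; rewrite -big_filter (bigD1_seq u) ?filter_uniq ?iota_uniq //=; last first.
  by rewrite mem_filter u0 mem_iota.
rewrite big_filter_cond; congr (_ + _); apply: eq_bigl => v; case: (v == u); first by rewrite andbF.
by rewrite andbT.
Qed.

Lemma sum_deg (a b : nat) : \sum_(v <- iota 0 n) (a + deg v * b) = n * a + M * b.
Proof.
rewrite big_split /= big_const_seq count_predT size_iota iter_addn addn0 mulnC.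
rewrite -big_distrl /=; congr (_ + _ * _).
suff sumE m : m <= n -> off 0 <= off m /\ \sum_(v <- iota 0 m) deg v = off m - off 0.
  by rewrite (sumE n (leqnn n)).2 off0 subn0 offn.
elim: m => [|m IH] mn; first by rewrite big_nil subnn.
have [le0 Em] := IH (ltnW mn); have := off_mono mn.
rewrite -addn1 iotaD big_cat /= big_cons big_nil addn0 add0n Em /deg addn1; lia.
Qed.

Hypothesis P_src : P src 0%R.
Hypothesis P_init : forall v, v < n -> P v (H src + H v)%R.

Lemma dijkstra_spec st : static st -> ivar st 6 = src ->
  term dijkstra st (n * L.+2 + M * L.+1 + 2) (fun st' =>
    row_ok (fun v => rarr st' 5 (src * n + v)) /\
    forall i, i < src * n -> rarr st' 5 i = rarr st 5 i).
Proof.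
move=> S s6; rewrite /dijkstra; set T := _ + 2.
have Tn : n < T by rewrite /T mulnS; lia.
have T0 : 0 < T by lia.
have nT : n * 1 < T by rewrite muln1.
apply: term_seq => //; apply: term_seq => //.
pose J k s := forall v, v < k ->
  [/\ rarr s 4 v = (H src + H v)%R, iarr s 10 v = 0 & iarr s 11 (n + v) = v].
apply: (@term_for _ 7 0 _ st n 1 _ J) => //; first exact: (static_n S); last first.
  move=> k s kn F sk Jk; have Ss := static_frame F isT S.
  have s6' : ivar s 6 = src by rewrite (frame_i F (x := 6) isT).
  apply: term_run => //; rewrite /J /= => v.
  rewrite ltnS leq_eqVlt sk s6' (static_n Ss) (static_H Ss) eqn_add2l.
  by case: eqP => [->|_ /= vk] //=; have [-> -> ->] := Jk v vk.
move=> s1 F1 J1; have S1 := static_frame F1 isT S.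
have s61 : ivar s1 6 = src by rewrite (frame_i F1 (x := 6) isT).
apply: term_run => //=; rewrite s61; set s2 := set_rarr _ _ _ _.
have S2 : static s2 by case: S1.
apply: term_seq => //.
have lv2 : leaves n (iarr s2 11) by move=> v /J1[].
apply: term_weaken (build_spec n_gt0 (static_n S2) lv2); first by lia.
move=> s3 F3 T3; have S3 := static_frame F3 isT S2.
have dn3 v : v < n -> iarr s3 10 v = 0 by move=> /J1[]; rewrite (frame_ia F3 (x := 10) isT).
have ds3 v : v < n -> rarr s3 4 v = if v == src then 0%R else (H src + H v)%R.
  by rewrite (frame_ra F3 (x := 4) isT) /= => /J1[->].
apply: term_seq => //; apply: term_seq => //; apply: term_run => //=.
have S30 : static (set_ivar s3 7 0) by case: S3.
(* The count [n - k] guarantees a vertex to extract in each iteration and none left at the end. The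
   credit is the total price of the remaining vertices, whichever order they come in. *)
pose I k f s := [/\ dinv s, \sum_(v <- iota 0 n | iarr s 10 v == 0) 1 = n - k &
  \sum_(v <- iota 0 n | iarr s 10 v == 0) (L.+2 + deg v * L.+1) < f].
apply: (@term_upto_credit _ 7 0 extract (set_ivar s3 7 0) T 0 n I) => //=.
- exact: (static_n S3).
- have E F : \sum_(v <- iota 0 n | iarr s3 10 v == 0) F v = \sum_(v <- iota 0 n) F v.
    rewrite big_seq_cond [RHS]big_seq; apply: eq_bigl => v.
    by rewrite mem_iota /=; case: ltnP => //= vn; rewrite dn3.
  split=> /=; last by rewrite E sum_deg /T; lia.
    split=> //=.
    + by move=> u v un _; rewrite dn3.
    + by move=> j /tl_lt jn; rewrite dn3.
    + by move=> v vn; rewrite ds3 //; case: eqP => [->|_] //; apply: P_init.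
    + by rewrite ds3 // eqxx.
  by rewrite E sum1_size size_iota subn0.
- move=> f s F [D Dn Df]; split; first by lia.
  have S4 := static_frame F isT S30.
  have alldone v : v < n -> 0 < iarr s 10 v.
    move=> vn; rewrite lt0n; apply/eqP => v0.
    by move: Dn; rewrite (sum_undone _ vn v0) subnn.
  have s64 : ivar s 6 = src.
    by rewrite (frame_i F (x := 6) isT) /= (frame_i F3 (x := 6) isT).
  have D4 : rarr s 5 = rarr st 5.
    rewrite (frame_ra F (x := 5) isT) /= (frame_ra F3 (x := 5) isT) /=.
    by rewrite (frame_ra F1 (x := 5) isT).
  pose K k s' := (forall v, v < k -> rarr s' 5 (src * n + v) = rarr s 4 v) /\
     forall i, i < src * n -> rarr s' 5 i = rarr st 5 i.
  apply: (@term_for _ 7 0 _ s n 1 _ K) => //=; first exact: (static_n S4).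
  + by split=> //= i _; rewrite D4.
  + move=> s' F' [K1 K2]; split=> //; split.
    * by rewrite K1 //; apply: (d_src D).
    * by move=> v vn; rewrite K1 //; apply: (d_valid D).
    * move=> j jM; rewrite !K1 ?hd_lt ?tl_lt //; apply: (d_relaxed D) => //.
      exact/alldone/tl_lt.
  + move=> k s' kn F' s'k [K1 K2]; have S' := static_frame F' isT S4.
    apply: term_run => //; rewrite /K /=.
    rewrite s'k (frame_i F' (x := 6) isT) s64 (static_row S') rowE //.
    rewrite (frame_ra F' (x := 4) isT).
    split=> [v|i im] /=; last by rewrite K2 //; case: eqP => //; lia.
    rewrite ltnS leq_eqVlt eqn_add2l; case: eqP => [->|_ /= vk] //=.
    exact: K1.
- move=> k f s kn F sk [D Dn Df]; have S4 := static_frame F isT S30.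
  have [v vn v0] : exists2 v, v < n & iarr s 10 v = 0.
    have [/hasP[v]|none] := boolP (has (fun v => iarr s 10 v == 0) (iota 0 n)).
      by rewrite mem_iota => /= vn /eqP v0; exists v.
    by move: Dn; rewrite big_hasC // => E; lia.
  have [u [un u0] Eu] := extract_spec S4 D vn v0.
  exists (L.+2 + deg u * L.+1), (f - (L.+2 + deg u * L.+1)).
  move: Dn Df; rewrite !(sum_undone _ un u0) => Dn Df; split=> //; first by lia.
  apply: term_weaken Eu => // s' _ [D' dn']; split=> //=.
  + by case: D' => *; split.
  + by rewrite dn'; lia.
  + by rewrite dn'; lia.
Qed.

End Source.

Variable P : nat -> nat -> R -> Prop.
Hypothesis P_step : forall u j x, u < n -> j < M -> P u (tl j) x -> P u (hd j) (x + wt j)%R.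
Hypothesis P_src : forall u, u < n -> P u u 0%R.
Hypothesis P_init : forall u v, u < n -> v < n -> P u v (H u + H v)%R.

Lemma all_pairs_spec st : static st ->
  term all_pairs st (n * (n * L.+2 + M * L.+1 + 2) + 1) (fun st' =>
    forall u, u < n -> row_ok u (P u) (fun v => rarr st' 5 (u * n + v))).
Proof.
move=> S.
apply: (@term_for _ 6 0 _ st n (n * L.+2 + M * L.+1 + 2) _ (fun k s =>
  forall u, u < k -> row_ok u (P u) (fun v => rarr s 5 (u * n + v)))) => //.
- exact: (static_n S).
- by lia.
- by lia.
- move=> k s kn F sk J; have Ss := static_frame F isT S.
  apply: term_weaken (dijkstra_spec kn (fun j x => P_step kn) (P_src kn)
    (fun v => @P_init k v kn) Ss sk) => // s' F' [rk same] u /=.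
  rewrite ltnS leq_eqVlt => /predU1P[->|uk] //.
  have E v : v < n -> rarr s' 5 (u * n + v) = rarr s 5 (u * n + v).
    move=> vn; apply: same; apply: leq_trans (_ : u.+1 * n <= _); first by rewrite mulSn; lia.
    by rewrite leq_mul2r uk orbT.
  have [J1 J2 J3] := J u uk; split=> [|v vn|j jM]; rewrite ?E ?hd_lt ?tl_lt //.
  - by lia.
  - exact: J2.
  - exact: J3.
Qed.

End Dijkstra.

(** * Sorting the darts, and the component of the source *)

(** The index language has no product and no halving, so row offsets and halves are tabulated by
    additions alone. *)
Definition tables : cmd :=
  ISet 6 0# ;;
  For 7 vN (IPut 7 [# 7] [# 6] ;; ISet 6 ([# 6] :+ [# vN]) ;;
            IPut 8 ([# 7] :+ [# 7]) [# 7] ;; IPut 8 ([# 7] :+ [# 7] :+ 1#) [# 7]).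

Definition push (other : nat) : cmd :=
  IPut 5 [# vCnt] [# 7] ;; IPut 6 [# vCnt] (IGet other [# 8]) ;;
  RPut 2 [# vCnt] (gW [# 8]) ;; Incr vCnt.
(** Sorting by one pass over all edges per tail costs about [n * m], which the bound allows. *)
Definition darts : cmd :=
  For 7 vN (IPut 4 [# 7] [# vCnt] ;;
            For 8 vM (If (IEq (gE1 [# 8]) [# 7]) (push 1) Skip ;;
                      If (IEq (gE2 [# 8]) [# 7]) (push 0) Skip)) ;;
  IPut 4 [# vN] [# vCnt].

(** Array 3 is written only when a vertex is first found, so it holds the length of some walk and
    not necessarily a distance. *)
Definition component : cmd :=
  IPut 9 [# vS] 1# ;;
  For 7 vN (For 8 vCnt
    (If (BAnd (ILe 1# (gCon (gTl [# 8]))) (ILe (gCon (gHd [# 8])) 0#))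
       (IPut 9 (gHd [# 8]) 1# ;; RPut 3 (gHd [# 8]) (gH (gTl [# 8]) :+: gWt [# 8]))
       Skip)).

Lemma tables_spec (R : realFieldType) n (st : state R) : ivar st 0 = n ->
  term tables st n.+1 (fun st' => (forall u, u < n -> iarr st' 7 u = u * n) /\
     forall i, i < n + n -> iarr st' 8 i = i./2).
Proof.
move=> sn; apply: term_seq => //; apply: term_run => //=.
apply: (@term_for _ 7 0 _ _ n 1 _ (fun k s => [/\ ivar s 6 = k * n,
  forall u, u < k -> iarr s 7 u = u * n & forall i, i < k + k -> iarr s 8 i = i./2])) => //=.
- by rewrite muln1.
- by move=> s F [].
- move=> k s kn F sk [J1 J2 J3]; apply: term_run => //=.
  have sn' : ivar s 0 = n by rewrite (frame_i F (x := 0) isT).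
  rewrite sk J1 sn'; split; first by rewrite mulSn addnC.
  + move=> u; rewrite ltnS leq_eqVlt; case: eqP => [->|_ /= uk] //=.
    exact: J2.
  + move=> i ik; case: eqP => [->|n1]; first by lia.
    case: eqP => [->|n2]; first by lia.
    by apply: J3; lia.
Qed.

(** * The list of darts grouped by tail *)

Section DartLists.
Variables (e1 e2 : nat -> nat).
Notation ndart := (nat * bool)%type.
Implicit Types d : ndart.

Definition ntail d := if d.2 then e1 d.1 else e2 d.1.
Definition nhead d := if d.2 then e2 d.1 else e1 d.1.

Definition edge_darts (m : nat) : seq ndart :=
  flatten [seq [:: (e, true); (e, false)] | e <- iota 0 m].

(** The darts with tail below [u]; the length of this list is the offset at which the darts with
    tail [u] begin. *)
Definition grouped (m u : nat) : seq ndart :=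
  flatten [seq [seq d <- edge_darts m | ntail d == v] | v <- iota 0 u].

Lemma edge_dartsS m : edge_darts m.+1 = edge_darts m ++ [:: (m, true); (m, false)].
Proof. by rewrite /edge_darts -addn1 iotaD map_cat flatten_cat. Qed.

Lemma groupedS m u : grouped m u.+1 = grouped m u ++ [seq d <- edge_darts m | ntail d == u].
Proof. by rewrite /grouped -addn1 iotaD map_cat flatten_cat /= cats0. Qed.

Lemma mem_edge_darts m d : (d \in edge_darts m) = (d.1 < m).
Proof.
case: d => e b; elim: m => [|m IH]; first by rewrite in_nil.
rewrite edge_dartsS mem_cat IH !inE !xpair_eqE ltnS [RHS]leq_eqVlt orbC /=.
by case: (b); rewrite /= ?andbT ?andbF ?orbF.
Qed.

Lemma size_edge_darts m : size (edge_darts m) = m.*2.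
Proof. by elim: m => // m IH; rewrite edge_dartsS size_cat IH doubleS addn2. Qed.

Lemma size_grouped m u : size (grouped m u) = count (fun d => ntail d < u) (edge_darts m).
Proof.
elim: u => [|u IH]; first by rewrite (eq_count (a2 := pred0)) ?count_pred0.
rewrite groupedS size_cat IH size_filter; elim: (edge_darts m) => //= d s <-.
by rewrite ltnS; case: (ltngtP (ntail d) u) => /=; lia.
Qed.

Lemma grouped_mono m u : size (grouped m u) <= size (grouped m u.+1).
Proof. by rewrite groupedS size_cat leq_addr. Qed.

Lemma mem_grouped m u d : (d \in grouped m u) = (d.1 < m) && (ntail d < u).
Proof.
elim: u => [|u IH]; first by rewrite andbF.
by rewrite groupedS mem_cat IH mem_filter mem_edge_darts ltnS (leq_eqVlt (ntail d)); case: (_ == _); case: (_ < _); case: (_ < _).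
Qed.

Variable d0 : ndart.

Lemma nth_grouped m u n j : u < n -> size (grouped m u) <= j < size (grouped m u.+1) ->
  ntail (nth d0 (grouped m n) j) = u.
Proof.
move=> un /andP[ju uj]; have -> : nth d0 (grouped m n) j = nth d0 (grouped m u.+1) j.
  elim: n un => // n IH; rewrite ltnS leq_eqVlt => /predU1P[<- //|un].
  rewrite groupedS nth_cat -IH // ifT //; apply: leq_trans uj _.
  elim: n un {IH} => // n IH; rewrite ltnS leq_eqVlt => /predU1P[<- //|/IH H].
  exact: leq_trans H (grouped_mono _ _).
move: uj; rewrite groupedS nth_cat size_cat (ltnNge j (size (grouped m u))) ju /= => uj.
set s := filter _ _ in uj *; have : nth d0 s (j - size (grouped m u)) \in s.
  by apply: mem_nth; rewrite ltn_subLR.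
by rewrite mem_filter => /andP[/eqP].
Qed.

Lemma grouped_range m n j u : j < size (grouped m n) -> ntail (nth d0 (grouped m n) j) = u ->
  size (grouped m u) <= j < size (grouped m u.+1).
Proof.
elim: n => // n IH; rewrite (groupedS m n) nth_cat size_cat.
case: (ltnP j (size (grouped m n))) => [jn _|nj jn] /=; first exact: IH.
set s := filter _ _ in jn *; have : nth d0 s (j - size (grouped m n)) \in s.
  by apply: mem_nth; rewrite ltn_subLR.
by rewrite mem_filter => /andP[/eqP-> _] <-; rewrite nj groupedS size_cat.
Qed.

Section Arrays.
Variables (R : realFieldType) (w : nat -> R).
Implicit Types st : state R.

Definition listed (s : seq ndart) st : Prop := ivar st 5 = size s /\
  forall j, j < size s -> [/\ iarr st 5 j = ntail (nth d0 s j),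
    iarr st 6 j = nhead (nth d0 s j) & rarr st 2 j = w (nth d0 s j).1].

Lemma listed_push st s other e (b : bool) : other <> 5 -> other <> 6 ->
  iarr st other = (if b then e2 else e1) -> rarr st 0 = w ->
  ivar st 8 = e -> ivar st 7 = ntail (e, b) ->
  listed s st -> listed (rcons s (e, b)) (run (push other) st).
Proof.
move=> o5 o6 Eo Ew s8 s7 [sz J]; split=> /=; first by rewrite sz size_rcons addn1.
move=> j; rewrite size_rcons ltnS leq_eqVlt nth_rcons sz.
case: eqP => [-> _|_ /= js]; last by rewrite js; apply: J.
rewrite ltnn /= s7 s8 Ew; split=> //; move: o5 o6 Eo.
by case: eqP => // _ _ _ ->; case: (b).
Qed.

Lemma darts_spec n m st : ivar st 0 = n -> ivar st 1 = m -> ivar st 5 = 0 ->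
  iarr st 0 = e1 -> iarr st 1 = e2 -> rarr st 0 = w ->
  term darts st (n * m.+2 + 2) (fun st' => listed (grouped m n) st' /\
    forall u, u <= n -> iarr st' 4 u = size (grouped m u)).
Proof.
move=> sn sm s5 sE1 sE2 sw; apply: term_seq; first by lia.
apply: (@term_for _ 7 0 _ st n m.+2 _ (fun k s => listed (grouped m k) s /\
  forall u, u < k -> iarr s 4 u = size (grouped m u))) => //.
- by lia.
- move=> s F [J1 J2]; apply: term_run => //=; first by lia.
  rewrite (frame_i F (x := 0) isT) sn J1.1.
  split=> // u un; case: eqP => [-> //|u_n]; apply: J2; lia.
move=> k s kn F sk [J1 J2]; apply: term_seq => //; apply: term_run => //=.
rewrite sk J1.1; set s1 := set_iarr _ _ _ _.
apply: (@term_for _ 8 1 _ s1 m 1 _ (fun e s' =>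
  listed (grouped m k ++ [seq d <- edge_darts e | ntail d == k]) s')) => //.
- by rewrite /= (frame_i F (x := 1) isT).
- by lia.
- by rewrite /= cats0; case: J1.
- move=> s2 F2 J; rewrite groupedS; split; first by case: J.
  move=> u uk /=; rewrite (frame_ia F2 (x := 4) isT) /=.
  case: eqP => [-> //|u_k]; apply: J2; lia.
move=> e s2 em F2 s2e J.
have [v7 g1 g2 g3] : [/\ ivar s2 7 = k, iarr s2 0 = e1, iarr s2 1 = e2 & rarr s2 0 = w].
  rewrite (frame_i F2 (x := 7) isT) (frame_ia F2 (x := 0) isT) (frame_ia F2 (x := 1) isT).
  rewrite (frame_ra F2 (x := 0) isT) /= sk (frame_ia F (x := 0) isT).
  by rewrite (frame_ia F (x := 1) isT) (frame_ra F (x := 0) isT).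
rewrite edge_dartsS filter_cat catA; set X := grouped m k ++ _ in J *.
have beqE x y s0 : beval s0 (IEq x y) = (ieval s0 x == ieval s0 y :> nat).
  by rewrite /= eqn_leq.
pose ok (s' : state R) := [/\ ivar s' 7 = k, ivar s' 8 = e, iarr s' 0 = e1, iarr s' 1 = e2 & rarr s' 0 = w].
suff : term (If (IEq (gE1 [#8]) [#7]) (push 1) Skip;; If (IEq (gE2 [#8]) [#7]) (push 0) Skip)
    s2 1 (listed (X ++ [seq d <- [:: (e, true); (e, false)] | ntail d == k])).
  by apply: term_weaken => // s3 _ [].
apply: term_seq => //.
have cont s3 Y : ok s3 -> listed Y s3 -> term (If (IEq (gE2 [#8]) [#7]) (push 0) Skip) s3 1
    (listed (Y ++ [seq d <- [:: (e, false)] | ntail d == k])).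
  case=> w7 w8 h1 h2 h3 JY; apply: term_if => //; rewrite beqE [ieval _ _]/= [ieval _ (IVar _)]/= w7 w8 h2 => E.
    have -> : [seq d <- [:: (e, false)] | ntail d == k] = [:: (e, false)] by rewrite /= /ntail /= E.
    apply: term_run => //; rewrite cats1.
    by apply: listed_push => //; rewrite w7 -(eqP E).
  have -> : [seq d <- [:: (e, false)] | ntail d == k] = [::] by rewrite /= /ntail /= (negbTE E).
  by rewrite cats0; apply: term_run.
have Ef : [seq d <- [:: (e, true); (e, false)] | ntail d == k] =
    [seq d <- [:: (e, true)] | ntail d == k] ++ [seq d <- [:: (e, false)] | ntail d == k].
  by rewrite -filter_cat.
rewrite Ef catA.
apply: term_if => //; rewrite beqE [ieval _ _]/= [ieval _ (IVar _)]/= s2e v7 g1 => E.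
  have -> : [seq d <- [:: (e, true)] | ntail d == k] = [:: (e, true)] by rewrite /= /ntail /= E.
  apply: term_run => //; apply: cont; first by split; rewrite /= ?s2e.
  by rewrite cats1; apply: listed_push => //; rewrite v7 -(eqP E).
have -> : [seq d <- [:: (e, true)] | ntail d == k] = [::] by rewrite /= /ntail /= (negbTE E).
by rewrite cats0; apply: term_run => //; apply: cont.
Qed.

End Arrays.
End DartLists.

(** * The component of the source as a least fixed point *)

Section Component.
Variables (R : realFieldType) (G : instance R) (M : nat).
Variables (lab : 'I_M -> 'I_(nE G) * bool) (tl hd : nat -> nat) (wt : nat -> R).
Hypothesis lab_onto : forall d, exists j, lab j = d.
Hypothesis tlE : forall j : 'I_M, tl j = dtail (lab j).
Hypothesis hdE : forall j : 'I_M, hd j = dhead (lab j).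
Hypothesis wtE : forall j : 'I_M, wt j = weight (lab j).1.
Notation V := (@AtVertex R G).

(** [fixset] iterates this monotone operator from the empty set once per vertex, which is exactly
    the number of sweeps of [component]. *)
Definition expand (X : {set 'I_(nV G)}) : {set 'I_(nV G)} :=
  source G |: [set dhead d | d in [pred d | @dtail _ G d \in X]].

Lemma expand_mono : {homo expand : X Y / X \subset Y}.
Proof.
move=> X Y XY; rewrite /expand setUS //; apply/subsetP=> v /imsetP[d dX ->].
by apply: imset_f; rewrite inE (subsetP XY).
Qed.

(** The fixed point is closed under darts in both orientations, so either end of an edge may stand
    for its inner points and membership propagates along a walk. *)
Lemma walk_fixset (u : 'I_(nV G)) c : walk (V (source G)) (V u) c -> u \in fixset expand.
Proof.
set X := fixset _; have EX : expand X = X by apply: fixsetK expand_mono.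
have XP d : dtail d \in X -> dhead d \in X.
  by move=> dX; rewrite -EX in_setU1; apply/orP; right; apply: imset_f.
pose inX (p : location G) := match p with
  | AtVertex v => v \in X | Inside e _ => (ends e).1 \in X end.
have in1 e x : inX (point e x) -> (ends e).1 \in X.
  rewrite /point; case: eqP => // _; case: eqP => // _; exact: (XP (e, false)).
have in2 e y : (ends e).1 \in X -> inX (point e y).
  rewrite /point; case: eqP => // _; case: eqP => // _; exact: (XP (e, true)).
suff H p q b : walk p q b -> inX p -> inX q.
  by move/H; apply; rewrite /= -EX in_setU1 eqxx.
by elim=> // e x y {}q a _ _ _ IH /in1 /(in2 e y).
Qed.

Lemma walk_head j (u : 'I_(nV G)) c : walk (V u) (V (dtail (lab j))) c ->
  walk (V u) (V (dhead (lab j))) (c + weight (lab j).1)%R.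
Proof.
move=> W; apply: walk_cat W _; rewrite -[weight _]mul1r -dpoint1.
by apply: walk_from_tail; rewrite ler01 lexx.
Qed.

Lemma component_spec (st : state R) :
  ivar st 0 = nV G -> ivar st 3 = source G -> ivar st 5 = M ->
  iarr st 5 = tl -> iarr st 6 = hd -> rarr st 2 = wt ->
  (forall u, iarr st 9 u = 0) -> (forall u, rarr st 3 u = 0%R) ->
  term component st (nV G * M.+2 + 2) (fun st' => forall u : 'I_(nV G),
    (0 < iarr st' 9 u -> walk (V (source G)) (V u) (rarr st' 3 u)) /\
    (forall c, walk (V (source G)) (V u) c -> 0 < iarr st' 9 u)).
Proof.
move=> sn ss sM st5 st6 st2 con0 H0; apply: term_seq; first by lia.
apply: term_run => //=; first by lia.
rewrite ss; set s1 := set_iarr _ _ _ _.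
pose J (s : state R) := 0 < iarr s 9 (source G) /\ forall u : 'I_(nV G), 0 < iarr s 9 u ->
  walk (V (source G)) (V u) (rarr s 3 u).
(* A sweep performs at least one application of [expand]; vertices found earlier in the same sweep
   can only add more. *)
pose K r (s : state R) := forall u, u \in iter r expand set0 -> 0 < iarr s 9 u.
apply: (@term_for _ 7 0 _ s1 (nV G) M.+2 _ (fun r s => J s /\ K r s)) => //.
- by lia.
- split=> [|u]; last by rewrite inE.
  split=> /= [|u]; first by rewrite eqxx.
  case: eqP => [/val_inj -> _|]; last by rewrite con0.
  by rewrite H0; constructor.
- move=> s F [[Js Jw] Ks] u; split=> [|c W]; first exact: Jw.
  by apply: Ks; move/walk_fixset: W; rewrite /fixset card_ord.
move=> r s rn F sr [Js Ks].
apply: (@term_for _ 8 5 _ s M 1 _ (fun j s' => [/\ J s', K r s' &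
    forall i : 'I_M, i < j -> dtail (lab i) \in iter r expand set0 -> 0 < iarr s' 9 (hd i)])) => //.
- by rewrite (frame_i F (x := 5) isT).
- by lia.
- move=> s' F' [J' K' L']; split=> // u; rewrite iterS in_setU1 => /orP[/eqP->|]; first exact: J'.1.
  case/imsetP=> d; rewrite inE => dX ->; have [i Ei] := lab_onto d.
  by rewrite -Ei -hdE //; apply: L' => //; rewrite Ei.
move=> j0 s' jM; have {j0 jM} [j ->] : exists j : 'I_M, j0 = j by exists (Ordinal jM).
move=> F' s'j [[J1 J2] K' L'].
have [E5 E6 E2] : [/\ iarr s' 5 = tl, iarr s' 6 = hd & rarr s' 2 = wt].
  rewrite (frame_ia F' (x := 5) isT) (frame_ia F (x := 5) isT).
  rewrite (frame_ia F' (x := 6) isT) (frame_ia F (x := 6) isT).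
  by rewrite (frame_ra F' (x := 2) isT) (frame_ra F (x := 2) isT).
apply: term_if => //=; rewrite s'j E5 E6 => cond; apply: term_run => //=; last first.
  split=> // i; rewrite ltnS leq_eqVlt => /predU1P[/ord_inj->|]; last exact: L'.
  move=> /K'; rewrite -tlE // => t0; move: cond; rewrite t0 /= -ltnNge //.
rewrite s'j E5 E6 E2; case/andP: cond => t0 h0; rewrite tlE // hdE // in t0 h0 *.
have up x : 0 < iarr s' 9 x -> 0 < (if x == dhead (lab j) then 1 else iarr s' 9 x).
  by case: eqP.
split=> /=.
- split=> [|u]; first exact: up.
  rewrite /=; case: (nat_of_ord u =P dhead (lab j)) => [/val_inj-> _|_]; last exact: J2.
  by rewrite wtE //; apply: walk_head; apply: J2.
- by move=> u /K' /up.
- move=> i; rewrite ltnS leq_eqVlt => /predU1P[/ord_inj->|ij iX]; first by rewrite hdE // eqxx.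
  by apply: up; apply: L'.
Qed.

End Component.

(** * The program for one agent *)

Definition lower (e : rexp) : cmd :=
  RSet 2 e ;; If (RLe (RVar 1) (RVar 2)) Skip (RSet 1 (RVar 2)).
Notation gDh e := (gD (gRow [# 7] :+ e)).
(** The minimum starts from a pick-up at the source, where the message can always be, so no infinite
    initial value is needed. *)
Definition costs : cmd :=
  For 8 vN (
    RSet 1 (gDh [# vS] :+: gD (gRow [# vS] :+ [# 8])) ;;
    For 9 vN (If (ILe 1# (gReach [# 9]))
      (lower (gDh [# 9] :+: gD (gRow [# 9] :+ [# 8]))) Skip) ;;
    For 9 vCnt (If (ILe 1# (gReach (gTl [# 9])))
      (lower (gDh (gHd [# 9]) :+: (gWt [# 9] :-: gA [# 9]) :+: (gWt [# 9] :-: gA [# 9])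
              :+: gD (gRow (gHd [# 9]) :+ [# 8]))) Skip) ;;
    RPut 7 [# 8] (RVar 1)).

Definition raise (e : rexp) : cmd :=
  RSet 2 e ;; If (RLe (RVar 2) (gWt [# 8])) Skip (RSet 2 (gWt [# 8])) ;;
  If (RLe (RVar 2) (RVar 1)) Skip (RSet 1 (RVar 2)).
Notation gTail := (gTl [# 8]).
Notation gHead := (gHd [# 8]).
Definition advance (v : version) : cmd :=
  RSet 1 (gA [# 8]) ;;
  (match v with
   | NonReturning =>
       raise (RVar 0 :-: gC gTail) ;;
       If (ILe 1# (gReach gTail))
         (raise (RVar 0 :-: gDh gHead :-: gWt [# 8] :+: (gA [# 8] :+: gA [# 8]))) Skip
   | Returning =>
       raise (RHalf (RVar 0 :-: gC gTail :-: gDh gTail)) ;;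
       If (RLe (gC gTail :+: gDh gHead :+: gWt [# 8]) (RVar 0)) (raise (gWt [# 8])) Skip ;;
       If (ILe 1# (gReach gTail))
         (raise (RHalf (RVar 0 :-: gDh gTail :-: gDh gHead :-: gWt [# 8]
                        :+: (gA [# 8] :+: gA [# 8]))) ;;
          If (RLe (gDh gHead :+: gDh gHead :+: (gWt [# 8] :-: gA [# 8])
                   :+: (gWt [# 8] :-: gA [# 8])) (RVar 0))
            (raise (gWt [# 8])) Skip) Skip
   end) ;;
  RPut 6 [# 8] (RVar 1).

Definition arrive (v : version) : cmd :=
  If (BAnd (ILe 1# (gCon [# 8]))
       (RLe (if v is Returning then gC [# 8] :+: gDh [# 8] else gC [# 8]) (RVar 0)))
    (IPut 12 [# 8] 1#) Skip.

Definition round (v : version) : cmd :=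
  ISet 7 (gStart (gTurn [# 6])) ;; RSet 0 (gB (gTurn [# 6])) ;;
  If (ILe 1# (gCon [# 7])) (costs ;; For 8 vCnt (advance v) ;; For 8 vN (arrive v)) Skip.

Definition delivery (v : version) : cmd :=
  tables ;; darts ;; component ;; all_pairs ;;
  IPut 12 [# vS] 1# ;; For 6 vK (round v) ;; ISet 0 (gReach [# vT]).

(** * How far one agent can carry the message along a dart *)

Section Frontier.
Variable R : realFieldType.
Local Open Scope ring_scope.

(** This is [max x (min y w)], written with the comparisons that the program makes. *)
Definition raised (w x y : R) : R :=
  let z := if y <= w then y else w in if z <= x then x else z.

(** The inequality of [extends] solved for [y]. A return by the tail counts [y] twice, hence the
    halved slack; in a return by the head [y] cancels, so either the whole dart is within reach or
    the case gives nothing. The flag [r] adds the pick-up inside the dart. *)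
Definition frontier (v : version) (B cT DT DH w a : R) (r : bool) : R :=
  match v with
  | NonReturning =>
      let x := raised w a (B - cT) in
      if r then raised w x (B - DH - w + (a + a)) else x
  | Returning =>
      let x := raised w a ((B - cT - DT) / 2) in
      let y := if cT + DH + w <= B then raised w x w else x in
      if r then
        let z := raised w y ((B - DT - DH - w + (a + a)) / 2) in
        if DH + DH + (w - a) + (w - a) <= B then raised w z w else z
      else y
  end.

Definition tracks (x : R) (s s' : state R) : Prop :=
  [/\ ivar s' = ivar s, iarr s' = iarr s, rarr s' = rarr s, rvar s' 0%N = rvar s 0%N &
      rvar s' 1%N = x].

(** [raise] writes only the real variables 1 and 2, so such an expression keeps its initial value
    throughout [advance] until array 6 is updated. *)
Fixpoint register_free (e : rexp) : bool :=
  match e with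
  | RVar x => x == 0%N
  | RAdd e1 e2 | RSub e1 e2 => register_free e1 && register_free e2
  | RHalf e1 => register_free e1
  | _ => true
  end.

Lemma tracks_ieval x s s' e : tracks x s s' -> ieval s' e = ieval s e.
Proof. by case=> E1 E2 _ _ _; elim: e => //= [y|a e ->|e -> f ->|e -> f ->] //; rewrite ?E1 ?E2. Qed.

Lemma tracks_reval x s s' e : tracks x s s' -> register_free e -> reval s' e = reval s e.
Proof.
move=> T; have [_ _ E3 E4 _] := T; elim: e => //=.
- by move=> y /eqP->.
- by move=> a e _; rewrite E3 (tracks_ieval _ T).
- by move=> e IHe f IHf /andP[/IHe-> /IHf->].
- by move=> e IHe f IHf /andP[/IHe-> /IHf->].
- by move=> e IHe /IHe->.
Qed.

Lemma tracks_eq x y s s' : tracks x s s' -> x = y -> tracks y s s'.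
Proof. by move=> T <-. Qed.

Lemma tracks_raise x s s' e : tracks x s s' -> register_free e ->
  tracks (raised (rarr s 2%N (ivar s 8%N)) x (reval s e)) s (run (raise e) s').
Proof.
move=> T /(tracks_reval T); case: T => E1 E2 E3 E4 E5; move: (reval s e) => y Ey.
rewrite /raise [run _ _]/= Ey E1 E3 /raised.
set w := rarr s _ _; case: (y <= w) => /=; rewrite E5.
  by case: (y <= x); split; rewrite /= ?E1 ?E3.
by case: (w <= x); split; rewrite /= ?E1 ?E3.
Qed.

Lemma tracks_rle x y z s s' e f p q : tracks z s s' -> register_free e && register_free f ->
  tracks x s (run p s') -> tracks y s (run q s') ->
  tracks (if reval s e <= reval s f then x else y) s (run (If (RLe e f) p q) s').
Proof.
move=> T /andP[Fe Ff] Tp Tq.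
by rewrite [run _ _]/= (tracks_reval T Fe) (tracks_reval T Ff); case: ifP.
Qed.

Lemma tracks_ile x y z s s' e f p q : tracks z s s' ->
  tracks x s (run p s') -> tracks y s (run q s') ->
  tracks (if (ieval s e <= ieval s f)%N then x else y) s (run (If (ILe e f) p q) s').
Proof.
by move=> T Tp Tq; rewrite [run _ _]/= !(tracks_ieval _ T); case: ifP.
Qed.

Lemma advance_run v (s : state R) j : ivar s 8%N = j ->
  let s' := run (advance v) s in
  [/\ ivar s' = ivar s, iarr s' = iarr s, rvar s' 0%N = rvar s 0%N &
      rarr s' = upd (rarr s) 6%N (upd (rarr s 6%N) j
        (frontier v (rvar s 0%N) (rarr s 7%N (iarr s 5%N j))
           (rarr s 5%N (iarr s 7%N (ivar s 7%N) + iarr s 5%N j)%N)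
           (rarr s 5%N (iarr s 7%N (ivar s 7%N) + iarr s 6%N j)%N)
           (rarr s 2%N j) (rarr s 6%N j) (0 < iarr s 12%N (iarr s 5%N j))%N))].
Proof.
move=> <-; rewrite /advance.
have start : tracks (rarr s 6%N (ivar s 8%N)) s (run (RSet 1 (gA [#8])) s) by split.
have stop x s1 : tracks x s s1 -> let s' := run (RPut 6 [#8] (RVar 1)) s1 in
    [/\ ivar s' = ivar s, iarr s' = iarr s, rvar s' 0%N = rvar s 0%N &
      rarr s' = upd (rarr s) 6%N (upd (rarr s 6%N) (ivar s 8%N) x)].
  by case=> E1 E2 E3 E4 E5; rewrite /= E1 E2 E3 E4 E5.
have seqE p q s1 : run (Seq p q) s1 = run q (run p s1) by [].
case: v; rewrite 2!seqE; apply: stop; apply: tracks_eq.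
- rewrite 2!seqE; have T1 := tracks_raise (e := RHalf (RVar 0 :-: gC gTail :-: gDh gTail)) start isT.
  have T2 := tracks_rle (e := gC gTail :+: gDh gHead :+: gWt [# 8]) (f := RVar 0)
    (q := Skip) T1 isT (tracks_raise (e := gWt [# 8]) T1 isT) T1.
  apply: (tracks_ile (q := Skip) _ _ T2 _ T2); rewrite seqE.
  have T3 := tracks_raise (e := RHalf (RVar 0 :-: gDh gTail :-: gDh gHead :-: gWt [# 8]
                        :+: (gA [# 8] :+: gA [# 8]))) T2 isT.
  by apply: (tracks_rle (q := Skip) T3 _ _ T3) => //; apply: (tracks_raise T3).
- by [].
- rewrite seqE; have T1 := tracks_raise (e := RVar 0 :-: gC gTail) start isT.
  apply: (tracks_ile (q := Skip) _ _ T1 _ T1); exact: (tracks_raise T1).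
- by [].
Qed.

Section FrontierSpec.
Variables (B cT DT DH w a : R) (r : bool).
Hypothesis a_bounds : 0 <= a <= w.

Let ret (v : version) (y : R) : R :=
  if v is Returning then Num.min (DT + y) (DH + w - y) else 0.
Let ext (v : version) (y : R) : Prop := cT + y + ret v y <= B \/
  [/\ r, a <= y & DH + (w - a) + (y - a) + ret v y <= B].

Let good (v : version) (x : R) : Prop := a <= x /\ (x = a \/ 0 <= x <= w /\ ext v x).

(** The candidate [y] may be negative or below [a]; it takes effect only above [x], which is at
    least [a], so [ext] is required from [a] on only. *)
Lemma raised_good v x y : good v x -> (forall z, a <= z -> z <= y -> z <= w -> ext v z) ->
  [/\ good v (raised w x y), x <= raised w x y &
      forall z, z <= y -> z <= w -> z <= raised w x y].
Proof.
case=> ax Hx He; have [a0 aw] := andP a_bounds; rewrite /raised.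
case: (lerP y w) => yw; case: ifP => H; split=> //; rewrite ?lexx //.
- by move=> z zy zw; apply: le_trans zy H.
- move/negbT: H; rewrite -ltNge => H; split; first by lra.
  by right; split; [lra|apply: He => //; lra].
- by apply: ltW; rewrite ltNge H.
- by move=> z zy zw; apply: le_trans zw H.
- move/negbT: H; rewrite -ltNge => H; split; first by lra.
  by right; split; [lra|apply: He => //; lra].
- by apply: ltW; rewrite ltNge H.
Qed.

(** In the Returning version [ext] has four cases, by place of pick-up and by the end used on the
    way home. Each is settled by one [raised], and later ones never lower the result. *)
Lemma frontier_ok v : let x := frontier v B cT DT DH w a r in
  [/\ x = a \/ 0 <= x <= w /\ ext v x, a <= x &
      forall y, 0 <= y <= w -> ext v y -> y <= x].
Proof.
have [a0 aw] := andP a_bounds.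
have good0 : good v a by split; [|left].
suff [[ax Hx] Hm] : good v (frontier v B cT DT DH w a r) /\
    forall y, 0 <= y <= w -> ext v y -> y <= frontier v B cT DT DH w a r by [].
have step := @raised_good v; case: v step good0 => step good0; rewrite /frontier.
- have [|g1 l1 m1] := step a ((B - cT - DT) / 2) good0.
    by move=> z az zB zw; left; rewrite /ret; case_min; move=> ?; lra.
  set x1 := raised w a _ in g1 l1 m1 *.
  set x2 := if _ then raised w x1 w else x1.
  have [g2 l2 m2] : [/\ good Returning x2, x1 <= x2 & cT + DH + w <= B -> forall z, z <= w -> z <= x2].
    rewrite /x2; case: ifP => H; last by split.
    have [|g l m] := step x1 w g1; last by split=> // _ z zw; apply: m.
    by move=> z az _ zw; left; rewrite /ret; case_min; move=> ?; lra.
  case: (boolP r) => Hr; last first.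
    split=> // y /andP[y0 yw] [|[]]; last by rewrite (negbTE Hr).
    rewrite /ret; case_min; move=> _ H; last by apply: m2 => //; lra.
    by apply: le_trans (m1 y _ _) l2; lra.
  have [|g3 l3 m3] := step x2 ((B - DT - DH - w + (a + a)) / 2) g2.
    by move=> z az zB zw; right; split=> //; rewrite /ret; case_min; move=> ?; lra.
  set x3 := raised w x2 _ in g3 l3 m3 *.
  set x4 := if _ then raised w x3 w else x3.
  have [g4 l4 m4] : [/\ good Returning x4, x3 <= x4 &
      DH + DH + (w - a) + (w - a) <= B -> forall z, z <= w -> z <= x4].
    rewrite /x4; case: ifP => H; last by split.
    have [|g l m] := step x3 w g3; last by split=> // _ z zw; apply: m.
    by move=> z az _ zw; right; split=> //; rewrite /ret; case_min; move=> ?; lra.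
  split=> // y /andP[y0 yw] [|[_ ay]]; rewrite /ret; case_min; move=> _ H.
  + by apply: le_trans (m1 y _ _) (le_trans l2 (le_trans l3 l4)); lra.
  + by apply: le_trans (m2 _ y _) (le_trans l3 l4) => //; lra.
  + by apply: le_trans (m3 y _ _) l4; lra.
  + by apply: m4 => //; lra.
- have [|g1 l1 m1] := step a (B - cT) good0.
    by move=> z az zB zw; left; rewrite /ret; lra.
  set x1 := raised w a _ in g1 l1 m1 *.
  case: (boolP r) => Hr; last first.
    split=> // y /andP[y0 yw] [|[]]; last by rewrite (negbTE Hr).
    by rewrite /ret => H; apply: m1; lra.
  have [|g2 l2 m2] := step x1 (B - DH - w + (a + a)) g1.
    by move=> z az zB zw; right; split=> //; rewrite /ret; lra.
  split=> // y /andP[y0 yw] [|[_ ay]]; rewrite /ret => H; last by apply: m2; lra.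
  by apply: le_trans (m1 y _ _) l2; lra.
Qed.

End FrontierSpec.
End Frontier.

Lemma if_le_left (R : realFieldType) (x y : R) : ((if x <= y then x else y) <= x)%R.
Proof. by case: (lerP x y) => [_|/ltW]. Qed.

Lemma if_le_right (R : realFieldType) (x y : R) : ((if x <= y then x else y) <= y)%R.
Proof. by case: (lerP x y). Qed.

(** * Correctness of the program for one agent *)

Section RoundProgram.
Variables (R : realFieldType) (G : instance R) (v : version) (M : nat).
Variables (off tl hd row hf con0 : nat -> nat) (wt H D0 : nat -> R).
Variable lab : 'I_M -> 'I_(nE G) * bool.
Notation n := (nV G).
Implicit Types st s : state R.

Record env st : Prop := Env {
  env_static : static n M off tl hd row hf wt H st;
  env_con : iarr st 9 = con0;
  env_D : rarr st 5 = D0;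
  env_s : ivar st 3 = source G;
  env_start : iarr st 2 = tabulate 0 (fun i : 'I_(nA G) => nat_of_ord (start i));
  env_turn : iarr st 3 = tabulate 0 (fun j : 'I_(nA G) => nat_of_ord (turn G j));
  env_budget : rarr st 1 = tabulate 0%R (@budget R G) }.

Lemma env_frame p st st' : frame p st st' ->
  [&& all (fun x => x \notin imods p) [:: 0; 5; 3],
      all (fun x => x \notin iamods p) [:: 4; 5; 6; 7; 8; 9; 2; 3] &
      all (fun x => x \notin ramods p) [:: 2; 3; 5; 1]] -> env st -> env st'.
Proof.
move=> F /and3P[/and4P[i0 i5 i3 _]].
move=> /and5P[a4 a5 a6 a7 /and5P[a8 a9 a2 a3 _]] /and5P[r2 r3 r5 r1 _].
case=> S Ec ED Es Est Et Eb; split.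
- by apply: static_frame F _ S; rewrite /= i0 i5 a4 a5 a6 a7 a8 r2 r3.
- by rewrite (frame_ia F).
- by rewrite (frame_ra F).
- by rewrite (frame_i F).
- by rewrite (frame_ia F).
- by rewrite (frame_ia F).
- by rewrite (frame_ra F).
Qed.

Definition D (x y : nat) : R := D0 (x * n + y).
Definition con (u : nat) : bool := 0 < con0 u.

Hypothesis rowE : forall u, u < n -> row u = u * n.
Hypothesis tlE : forall j : 'I_M, tl j = dtail (lab j).
Hypothesis hdE : forall j : 'I_M, hd j = dhead (lab j).
Hypothesis wtE : forall j : 'I_M, wt j = weight (lab j).1.
Hypothesis lab_onto : forall d, exists j, lab j = d.

Section Costs.
Variables (h : nat) (r0 : nat -> nat) (a0 : nat -> R).
Hypothesis h_lt : h < n.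
Hypothesis r0s : 0 < r0 (source G).

Definition vertex_cost (u x : nat) : R := (D h x + D x u)%R.
Definition dart_cost (u j : nat) : R :=
  (D h (hd j) + (wt j - a0 j) + (wt j - a0 j) + D (hd j) u)%R.

Definition attained (u : nat) (x : R) : Prop :=
  (exists y, [/\ y < n, 0 < r0 y & x = vertex_cost u y]) \/
  (exists j, [/\ j < M, 0 < r0 (tl j) & x = dart_cost u j]).

Definition cost_ok (u : nat) (x : R) : Prop :=
  [/\ attained u x,
      forall y, y < n -> 0 < r0 y -> (x <= vertex_cost u y)%R &
      forall j, j < M -> 0 < r0 (tl j) -> (x <= dart_cost u j)%R].

Lemma costs_spec st : env st -> ivar st 7 = h -> iarr st 12 = r0 -> rarr st 6 = a0 ->
  term costs st (n * (n + M + 1) + 1) (fun st' => forall u, u < n -> cost_ok u (rarr st' 7 u)).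
Proof.
move=> E st7 st12 st6.
have hd_n j : j < M -> hd j < n by move=> jM; rewrite (hdE (Ordinal jM)).
apply: (@term_for _ 8 0 _ st n (n + M + 1) _
  (fun k s => forall u, u < k -> cost_ok u (rarr s 7 u))) => //.
- exact: static_n (env_static E).
- by lia.
- by lia.
move=> u s un F su J; have Es := env_frame F isT E; have Ss := env_static Es.
have F1 : 0 < n + M + 1 by lia.
have [s7 s12 s6] : [/\ ivar s 7 = h, iarr s 12 = r0 & rarr s 6 = a0].
  by rewrite (frame_i F (x := 7) isT) (frame_ia F (x := 12) isT) (frame_ra F (x := 6) isT).
apply: term_seq => //; apply: term_run => //=.
rewrite s7 (env_s Es) su (env_D Es) (static_row Ss) !rowE // -/(D _ _) -/(D _ _) -/(vertex_cost _ _).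
set s1 := set_rvar _ _ _; have Es1 : env s1 by case: Es => -[*]; split.
apply: term_seq => //.
pose I (k : nat) (x : R) := attained u x /\
  forall y, y < k -> 0 < r0 y -> (x <= vertex_cost u y)%R.
apply: (@term_for _ 9 0 _ s1 n 1 _ (fun k s => I k (rvar s 1))) => //.
- exact: static_n (env_static Es1).
- by lia.
- by split=> //=; left; exists (source G).
- move=> s2 F2 [I1 I2]; have Es2 := env_frame F2 isT Es1; apply: term_seq => //.
  have [s72 s122 s62 s82] : [/\ ivar s2 7 = h, iarr s2 12 = r0, rarr s2 6 = a0 & ivar s2 8 = u].
    rewrite (frame_i F2 (x := 7) isT) (frame_ia F2 (x := 12) isT).
    by rewrite (frame_ra F2 (x := 6) isT) (frame_i F2 (x := 8) isT).
  apply: (@term_for _ 9 5 _ s2 M 1 _ (fun k s => [/\ attained u (rvar s 1),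
      forall y, y < n -> 0 < r0 y -> (rvar s 1 <= vertex_cost u y)%R &
      forall j, j < k -> 0 < r0 (tl j) -> (rvar s 1 <= dart_cost u j)%R])) => //.
  + exact: static_M (env_static Es2).
  + by lia.
  + move=> s3 F3 I3; apply: term_run => //= x; rewrite ltnS leq_eqVlt.
    have -> : ivar s3 8 = u by rewrite (frame_i F3 (x := 8) isT).
    have -> : rarr s3 7 = rarr s 7.
      by rewrite (frame_ra F3 (x := 7) isT) (frame_ra F2 (x := 7) isT).
    by case: eqP => [-> _|_ /= xu]; [|apply: J].
  + move=> j s3 jM F3 s3j [I3 I4 I5]; have Es3 := env_frame F3 isT Es2.
    have Ss3 := env_static Es3.
    have [s73 s123 s63 s83] : [/\ ivar s3 7 = h, iarr s3 12 = r0, rarr s3 6 = a0 & ivar s3 8 = u].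
      rewrite (frame_i F3 (x := 7) isT) (frame_ia F3 (x := 12) isT).
      by rewrite (frame_ra F3 (x := 6) isT) (frame_i F3 (x := 8) isT).
    apply: term_if => //; rewrite [beval _ _]/= s3j s123 (static_tl Ss3) => rj; last first.
      apply: term_run => //; split=> // i; rewrite ltnS leq_eqVlt => /predU1P[-> ri|]; last exact: I5.
      by rewrite ri in rj.
    apply: term_run => //; set e := _ :+: gD _; set s4 := run _ s3.
    have -> : rvar (set_ivar s4 9 j.+1) 1 = (if rvar s3 1 <= dart_cost u j then rvar s3 1
        else dart_cost u j)%R.
      rewrite /s4 /= s73 s3j s63 s83 (static_hd Ss3) (static_row Ss3) (static_wt Ss3) (env_D Es3).
      rewrite !rowE ?hd_n // -/(D _ _) -/(D _ _) -/(dart_cost u j).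
      by case: ifP.
    split; first by case: ifP => // _; right; exists j.
      by move=> y yn ry; apply: le_trans (I4 y yn ry); exact: if_le_left.
    move=> i; rewrite ltnS leq_eqVlt => /predU1P[-> _|ij ri]; first exact: if_le_right.
    by apply: le_trans (I5 i ij ri); exact: if_le_left.
- move=> x s2 xn F2 s2x [I1 I2]; have Es2 := env_frame F2 isT Es1.
  have Ss2 := env_static Es2.
  have [s72 s122 s82] : [/\ ivar s2 7 = h, iarr s2 12 = r0 & ivar s2 8 = u].
    rewrite (frame_i F2 (x := 7) isT) (frame_ia F2 (x := 12) isT).
    by rewrite (frame_i F2 (x := 8) isT).
  apply: term_if => //; rewrite [beval _ _]/= s2x s122 => rx; last first.
    apply: term_run => //; split=> // i; rewrite ltnS leq_eqVlt => /predU1P[-> ri|]; last exact: I2.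
    by rewrite ri in rx.
  apply: term_run => //; set e := _ :+: gD _; set s4 := run _ s2.
  have -> : rvar (set_ivar s4 9 x.+1) 1 = (if rvar s2 1 <= vertex_cost u x then rvar s2 1
      else vertex_cost u x)%R.
    rewrite /s4 /= s72 s2x s82 (static_row Ss2) (env_D Es2) !rowE // -/(D _ _) -/(D _ _).
    rewrite -/(vertex_cost u x).
    by case: ifP.
  split; first by case: ifP => // _; left; exists x.
  move=> i; rewrite ltnS leq_eqVlt => /predU1P[-> _|ij ri]; first exact: if_le_right.
  by apply: le_trans (I2 i ij ri); exact: if_le_left.
Qed.

End Costs.

Definition reachf st (u : nat) : bool := 0 < iarr st 12 u.

(** The Returning program modifies at least the same names, so frame conditions can be computed for
    it while the version is still a variable. *)
Lemma frame_advance w s s' : frame (For 8 5 (advance w)) s s' ->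
  frame (For 8 5 (advance Returning)) s s'.
Proof. by case: w => // F; apply: frame_mono F; apply/allP. Qed.

Lemma frame_round w s s' : frame (For 6 2 (round w)) s s' ->
  frame (For 6 2 (round Returning)) s s'.
Proof. by case: w => // F; apply: frame_mono F; apply/allP. Qed.

Lemma advance_spec st h : h < n -> env st -> ivar st 7 = h ->
  term (For 8 5 (advance v)) st M.+1 (fun st' => forall j, j < M ->
    rarr st' 6 j = frontier v (rvar st 0) (rarr st 7 (tl j)) (D h (tl j)) (D h (hd j))
      (wt j) (rarr st 6 j) (0 < iarr st 12 (tl j))).
Proof.
move=> hn E st7; have hd_n j : j < M -> hd j < n by move=> jM; rewrite (hdE (Ordinal jM)).
have tl_n j : j < M -> tl j < n by move=> jM; rewrite (tlE (Ordinal jM)).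
apply: (@term_for _ 8 5 _ st M 1 _ (fun k s => (forall j, j < k ->
  rarr s 6 j = frontier v (rvar st 0) (rarr st 7 (tl j)) (D h (tl j)) (D h (hd j))
      (wt j) (rarr st 6 j) (0 < iarr st 12 (tl j))) /\
  forall j, k <= j -> rarr s 6 j = rarr st 6 j)) => //.
- by case: (v).
- by case: (v).
- exact: static_M (env_static E).
- by lia.
- by move=> s _ [].
move=> j s jM /frame_advance F sj [J1 J2]; have Es := env_frame F isT E; have Ss := env_static Es.
have [s7 s12 s0 sc] : [/\ ivar s 7 = h, iarr s 12 = iarr st 12, rvar s 0 = rvar st 0 & rarr s 7 = rarr st 7].
  rewrite (frame_i F (x := 7) isT) (frame_ia F (x := 12) isT).
  by rewrite (frame_r F (x := 0) isT) (frame_ra F (x := 7) isT).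
have [_ _ _ E6] := advance_run v sj.
apply: term_run => //; first by case: (v).
have -> : rarr (set_ivar (run (advance v) s) 8 j.+1) 6 = upd (rarr s 6) j
    (frontier v (rvar st 0) (rarr st 7 (tl j)) (D h (tl j)) (D h (hd j))
      (wt j) (rarr st 6 j) (0 < iarr st 12 (tl j))).
  rewrite (_ : rarr (set_ivar _ _ _) = rarr (run (advance v) s)) // E6 /=; rewrite s7 s12 s0 sc (static_tl Ss) (static_hd Ss) (static_row Ss) (static_wt Ss) (env_D Es).
  by rewrite rowE // J2.
split=> i.
  by rewrite ltnS leq_eqVlt /=; case: eqP => [->|_ /= ij] //; apply: J1.
by move=> ji; rewrite /= gtn_eqF //; apply: J2; apply: ltnW.
Qed.

Lemma arrive_spec st h : h < n -> env st -> ivar st 7 = h ->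
  term (For 8 0 (arrive v)) st n.+1 (fun st' => forall u, u < n ->
    reachf st' u = reachf st u || con u &&
      (rarr st 7 u + (if v is Returning then D h u else 0) <= rvar st 0)%R).
Proof.
move=> hn E st7.
apply: (@term_for _ 8 0 _ st n 1 _ (fun k s => (forall u, u < k ->
  reachf s u = reachf st u || con u &&
      (rarr st 7 u + (if v is Returning then D h u else 0) <= rvar st 0)%R) /\
  forall u, k <= u -> iarr s 12 u = iarr st 12 u)) => //.
- exact: static_n (env_static E).
- by lia.
- by move=> s _ [].
move=> u s un F su [J1 J2]; have Es := env_frame F isT E; have Ss := env_static Es.
have [s7 s0 sc] : [/\ ivar s 7 = h, rvar s 0 = rvar st 0 & rarr s 7 = rarr st 7].
  rewrite (frame_i F (x := 7) isT).
  by rewrite (frame_r F (x := 0) isT) (frame_ra F (x := 7) isT).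
have cE : beval s (BAnd (ILe 1# (gCon [# 8]))
       (RLe (if v is Returning then gC [# 8] :+: gDh [# 8] else gC [# 8]) (RVar 0))) =
    con u && (rarr st 7 u + (if v is Returning then D h u else 0) <= rvar st 0)%R.
  by case: (v); rewrite /= su ?s7 s0 sc (env_con Es) ?addr0 // (static_row Ss) (env_D Es) rowE.
apply: term_if => //; rewrite cE => Hb; apply: term_run => //; split=> i.
- rewrite ltnS leq_eqVlt /= /reachf /= su; case: eqP => [->|_ /= iu]; last exact: J1.
  by rewrite Hb orbT.
- by move=> ui; rewrite /= su gtn_eqF //; apply: J2; apply: ltnW.
- rewrite ltnS leq_eqVlt => /predU1P[->|]; last exact: J1.
  by rewrite (negbTE Hb) orbF /reachf /= J2.
- by move=> ui; apply: J2; apply: ltnW.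
Qed.

Lemma tabulateE (T : Type) (d : T) (k : nat) (f : 'I_k -> T) (i : 'I_k) : tabulate d f i = f i.
Proof. by rewrite /tabulate valK. Qed.

Lemma handover_walk l p q : @handover R G v l p q -> exists c, walk p q c.
Proof.
elim=> [{}p|//|i m {}p q' r Hc _ [c Wc]]; first by exists 0%R; constructor.
suff [b W] : exists b, walk p q' b by exists (b + c)%R; apply: walk_cat Wc.
by move: Hc; case: (v) => /= [[a [b [c' [_ W _ _]]]]|[a [b [_ W _]]]]; exists b.
Qed.

Lemma handover_stay l p : @handover R G v l p p.
Proof. by elim: l => [|i l IH]; [constructor|apply: handover_idle]. Qed.

Notation V := (@AtVertex R G).
Hypothesis con_walk : forall u : 'I_n, con u -> exists c, walk (V (source G)) (V u) c.
Hypothesis con_closed : forall (u : 'I_n) c, walk (V (source G)) (V u) c -> con u.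
Hypothesis D_diag : forall u : 'I_n, con u -> D u u = 0%R.
Hypothesis D_dart : forall (u : 'I_n) d, con u ->
  (D u (@dhead _ G d) <= D u (dtail d) + weight d.1)%R.
Hypothesis D_walk : forall u w : 'I_n, con u -> con w -> walk (V u) (V w) (D u w).

Definition solved (l : seq 'I_(nA G)) st : Prop :=
  sound con v lab l (reachf st) (rarr st 6) /\ complete v lab l (reachf st) (rarr st 6).

Lemma round_spec st l (j : 'I_(nA G)) : env st -> ivar st 6 = j -> solved l st ->
  term (round v) st (n * (n + M + 1) + M + 2) (solved (rcons l (turn G j))).
Proof.
move=> E st6 [Hs Hc]; set F := _ + 2; set i := turn G j; set h := start i.
have n0 : 0 < n by apply: leq_ltn_trans (ltn_ord (source G)).
have F0 : 0 < F by rewrite /F; lia.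
apply: term_seq => //; apply: term_run => //=.
apply: term_seq => //; apply: term_run => //=.
rewrite st6 (env_turn E) (env_start E) (env_budget E) !tabulateE -/i -/h.
set s1 := set_rvar _ _ _; have E1 : env s1 by case: E => -[*]; split.
(* An agent outside the component cannot meet the message: its walk to the pick-up, reversed, would
   join its home to the source. *)
apply: term_if => //; rewrite [beval _ _]/= (env_con E) -/(con h) => ch; last first.
  apply: term_run => //; have [Hr Hf Hcn Ha] := Hs; split.
    split=> //.
    - by move=> u /Hr; apply: handover_rcons_idle.
    - move=> k rk; have [z [z01 Ez Hz]] := Hf k rk; exists z; split=> //.
      exact: handover_rcons_idle.
  move=> q /handover_rconsE[/Hc //|[p Hp Hcar]].
  have [c Wc] := handover_walk Hp; case/negP: ch.
  have [b Wb] : exists b, walk (V h) p b.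
    by move: Hcar; case: (v) => /= [[b [b' [b'' [W _ _ _]]]]|[b [b' [W _ _]]]]; exists b.
  exact: con_closed (walk_cat Wc (walk_rev Wb)).
(* All earlier agents may stay idle, so completeness puts the source among the reached vertices. *)
have r0s : 0 < iarr s1 12 (source G) by apply: (Hc (V (source G))); apply: handover_stay.
apply: term_seq => //; apply: term_weaken (costs_spec (h := h) (ltn_ord _) r0s E1 erefl erefl erefl).
  by rewrite /F; lia.
move=> s2 F2 C2; have E2 := env_frame F2 isT E1.
have [e7 e12 e6 eB] : [/\ ivar s2 7 = h, iarr s2 12 = iarr st 12, rarr s2 6 = rarr st 6 & rvar s2 0 = budget i].
  rewrite (frame_i F2 (x := 7) isT) (frame_ia F2 (x := 12) isT).
  by rewrite (frame_ra F2 (x := 6) isT) (frame_r F2 (x := 0) isT).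
apply: term_seq => //; apply: term_weaken (advance_spec (h := h) (ltn_ord _) E2 e7).
  by rewrite /F; lia.
move=> s3 /frame_advance F3 A3; have E3 := env_frame F3 isT E2.
have [g7 g12 gc gB] : [/\ ivar s3 7 = h, iarr s3 12 = iarr st 12, rarr s3 7 = rarr s2 7 & rvar s3 0 = budget i].
  rewrite (frame_i F3 (x := 7) isT) (frame_ia F3 (x := 12) isT).
  by rewrite (frame_ra F3 (x := 7) isT) (frame_r F3 (x := 0) isT).
apply: term_weaken (arrive_spec (h := h) (ltn_ord _) E3 g7).
  by rewrite /F mulnDr mulnDr; lia.
move=> s4 F4 R4; have a4 : rarr s4 6 = rarr s3 6 by rewrite (frame_ra F4 (x := 6) isT).
have reach'E (u : 'I_n) : reachf s4 u = reachf st u ||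
    con u && (rarr s2 7 u + retcost D v i (V u) <= budget i)%R.
  by rewrite R4 // /reachf g12 gc gB /retcost; case: (v).
have le_vertex (u w : 'I_n) : con u -> reachf st w -> (rarr s2 7 u <= D h w + D w u)%R.
  by move=> _ rw; have [_ H1 _] := C2 u (ltn_ord u); apply: H1.
have le_dart (u : 'I_n) (k : 'I_M) : con u -> reachf st (dtail (lab k)) ->
    (rarr s2 7 u <= D h (dhead (lab k)) + (weight (lab k).1 - rarr st 6 k) +
       (weight (lab k).1 - rarr st 6 k) + D (dhead (lab k)) u)%R.
  move=> _ rk; have [_ _ H1] := C2 u (ltn_ord u).
  by have := H1 k (ltn_ord k); rewrite tlE // /dart_cost hdE // wtE //; apply.
have bounds (k : 'I_M) : con (dtail (lab k)) -> (0 <= rarr st 6 k <= weight (lab k).1)%R.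
  have [_ Hf _ Ha] := Hs => ck; have [a0 an] := Ha k ck; rewrite a0.
  have [rk|nrk] := boolP (reachf st (dtail (lab k))); last by rewrite an // weight_ge0.
  by have [z [/andP[z0 z1] <- _]] := Hf k rk; rewrite ler_piMl // weight_ge0.
have front (k : 'I_M) (ck : con (dtail (lab k))) :=
  frontier_ok (budget i) (rarr s2 7 (dtail (lab k))) (D h (dtail (lab k)))
    (D h (dhead (lab k))) (reachf st (dtail (lab k))) (bounds k ck) v.
have a'E (k : 'I_M) : rarr s4 6 k = frontier v (budget i) (rarr s2 7 (dtail (lab k)))
    (D h (dtail (lab k))) (D h (dhead (lab k))) (weight (lab k).1) (rarr st 6 k)
    (reachf st (dtail (lab k))).
  by rewrite a4 A3 // tlE // hdE // wtE // eB e6 e12.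
have ext (k : 'I_M) : con (dtail (lab k)) -> rarr s4 6 k = rarr st 6 k \/
    (0 <= rarr s4 6 k <= weight (lab k).1)%R /\
    extends D v i lab (reachf st) (rarr st 6) (rarr s2 7) k (rarr s4 6 k).
  by move=> ck; rewrite a'E //; have [H1 _ _] := front k ck.
have max (k : 'I_M) : con (dtail (lab k)) -> (rarr st 6 k <= rarr s4 6 k)%R /\
    forall y, (0 <= y <= weight (lab k).1)%R ->
    extends D v i lab (reachf st) (rarr st 6) (rarr s2 7) k y -> (y <= rarr s4 6 k)%R.
  by move=> ck; rewrite a'E //; have [_ H1 H2] := front k ck.
split; last first.
  exact: (round_complete con_walk con_closed D_diag D_dart D_walk lab_onto ch Hs
    le_vertex le_dart reach'E max Hc).
apply: (round_sound con_walk con_closed D_dart D_walk ch Hs _ reach'E ext max).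
move=> u cu; have [[[y [yn ry ->]]|[k [kM rk ->]]] _ _] := C2 u (ltn_ord u).
  by left; exists (Ordinal yn).
by right; exists (Ordinal kM); rewrite /reachf -tlE -hdE -wtE.
Qed.

End RoundProgram.

(** * The whole program *)

Definition delivery_time (n m k : nat) : nat :=
  n * (n * (trunc_log 2 n).+3 + m.*2 * (trunc_log 2 n).+2 + 2) + n * m.*2.+2
  + k * (n * (n + m.*2 + 1) + m.*2 + 2) + n + 3.

(** Two vertices make the logarithm positive, whence [n <= n * l], and [k > 0] lets the preliminary
    phases be charged to one agent. The bounds below add up to 27 multiples of the product, so 50
    leaves slack. *)
Lemma delivery_time_le n m k : 1 < n -> 0 < k ->
  delivery_time n m k <= 50 * (k * (n + m) * (n * trunc_log 2 n + m)).
Proof.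
move=> n1 k0; have l0 : 0 < trunc_log 2 n by rewrite trunc_log_gt0.
rewrite /delivery_time; move: (trunc_log 2 n) l0 => l l0.
have H1 : n <= n * l by rewrite leq_pmulr.
set x := n * l in H1 *.
have kx : (n + m) * (x + m) <= k * ((n + m) * (x + m)) by rewrite leq_pmull.
have nn : n * n <= n * x by rewrite leq_mul2l H1 orbT.
have mn : m * n <= m * x by rewrite leq_mul2l H1 orbT.
have n_nn : n <= n * n by rewrite leq_pmull //; lia.
have m_mn : m <= m * n by rewrite leq_pmulr //; lia.
have XE : (n + m) * (x + m) = n * x + n * m + m * x + m * m by lia.
have H2 : n * (n * l.+3 + m.*2 * l.+2 + 2) <= 10 * ((n + m) * (x + m)).
  have -> : n * (n * l.+3 + m.*2 * l.+2 + 2) =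
    n * x + 3 * (n * n) + 2 * (m * x) + 4 * (m * n) + 2 * n by rewrite /x -muln2; lia.
  lia.
have H3 : n * m.*2.+2 <= 4 * ((n + m) * (x + m)).
  have -> : n * m.*2.+2 = 2 * (m * n) + 2 * n by rewrite -muln2; lia.
  lia.
have H4 : n * (n + m.*2 + 1) + m.*2 + 2 <= 10 * ((n + m) * (x + m)).
  have -> : n * (n + m.*2 + 1) = n * n + 2 * (m * n) + n by rewrite -muln2; lia.
  lia.
have H5 : n + 3 <= 3 * ((n + m) * (x + m)) by lia.
have H6 : k * (n * (n + m.*2 + 1) + m.*2 + 2) <= k * (10 * ((n + m) * (x + m))).
  by rewrite leq_mul2l H4 orbT.
rewrite -[k * (n + m) * _]mulnA; lia.
Qed.

Section Delivery.
Variables (R : realFieldType) (G : instance R) (v : version).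
Notation n := (nV G).
Notation m := (nE G).
Notation k := (nA G).
Notation V := (@AtVertex R G).
Local Notation s0 := (input G).
Local Notation e1 := (iarr s0 0).
Local Notation e2 := (iarr s0 1).
Local Notation d0 := (0, true).
Local Notation DL := (grouped e1 e2 m n).
Local Notation M := (size DL).

Lemma ntailE (d : 'I_m * bool) : ntail e1 e2 (nat_of_ord d.1, d.2) = dtail d.
Proof. by case: d => e []; rewrite /ntail /dtail /= tabulateE. Qed.

Lemma nheadE (d : 'I_m * bool) : nhead e1 e2 (nat_of_ord d.1, d.2) = dhead d.
Proof. by case: d => e []; rewrite /nhead /dhead /= tabulateE. Qed.

Lemma labelling : exists lab : 'I_M -> 'I_m * bool,
  (forall j : 'I_M, nth d0 DL j = (nat_of_ord (lab j).1, (lab j).2)) /\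
  forall d, exists j, lab j = d.
Proof.
have labE (j : 'I_M) : exists d : 'I_m * bool, nth d0 DL j = (nat_of_ord d.1, d.2).
  have := mem_nth d0 (ltn_ord j).
  rewrite mem_grouped; case: (nth _ _ _) => e b /andP[/= em _].
  by exists (Ordinal em, b).
have {labE} [lab labE] := fin_all_exists labE.
exists lab; split=> // d.
have dDL : (nat_of_ord d.1, d.2) \in DL by rewrite mem_grouped ltn_ord ntailE ltn_ord.
have jM : index (nat_of_ord d.1, d.2) DL < M by rewrite index_mem.
exists (Ordinal jM); have := labE (Ordinal jM); rewrite /= nth_index //.
move: (lab _) => [e' b'] /= [Ee Eb]; rewrite -Eb [d]surjective_pairing; congr (_, _).
by apply/esym/ord_inj.
Qed.

Lemma size_darts : M <= m.*2.
Proof. by rewrite size_grouped -(size_edge_darts m) count_size. Qed.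

Lemma delivery_spec : term (delivery v) s0 (delivery_time n m k)
  (fun s => accepts s <-> fixed_order_delivery G v).
Proof.
have [lab [labE lab_onto]] := labelling; have ML := size_darts.
have n0 : 0 < n by apply: leq_ltn_trans (ltn_ord (source G)).
set L := (trunc_log 2 n).+1; have nL : n <= 2 ^ L by apply/ltnW/trunc_log_ltn.
set F := delivery_time n m k; have F0 : 0 < F by rewrite /F /delivery_time; lia.
have [b1 b2 b3 b4] : [/\ n * m.+2 + 2 <= F, n * M.+2 + 2 <= F,
    n * (n * L.+2 + M * L.+1 + 2) + 1 <= F & k * (n * (n + M + 1) + M + 2) < F].
  have c1 : n * m.+2 <= n * m.*2.+2 by rewrite leq_mul2l; lia.
  have c2 : n * M.+2 <= n * m.*2.+2 by rewrite leq_mul2l; lia.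
  have c3 : M * L.+1 <= m.*2 * L.+1 by rewrite leq_mul2r ML orbT.
  have c4 : n * (n * L.+2 + M * L.+1 + 2) <= n * (n * L.+2 + m.*2 * L.+1 + 2).
    by rewrite leq_mul2l; lia.
  have c5 : n * (n + M + 1) <= n * (n + m.*2 + 1) by rewrite leq_mul2l; lia.
  have c6 : k * (n * (n + M + 1) + M + 2) <= k * (n * (n + m.*2 + 1) + m.*2 + 2).
    by rewrite leq_mul2l; lia.
  by rewrite /F /delivery_time -/L; split; lia.
apply: term_seq => //; apply: term_weaken (tables_spec (n := n) (st := s0) erefl).
  by rewrite /F /delivery_time; lia.
move=> s1 F1 [row1 half1].
have [q0 q1 q5] : [/\ ivar s1 0 = n, ivar s1 1 = m & ivar s1 5 = 0].
  rewrite (frame_i F1 (x := 0) isT) (frame_i F1 (x := 1) isT).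
  by rewrite (frame_i F1 (x := 5) isT).
have [qe1 qe2 qw] : [/\ iarr s1 0 = e1, iarr s1 1 = e2 & rarr s1 0 = rarr s0 0].
  rewrite (frame_ia F1 (x := 0) isT) (frame_ia F1 (x := 1) isT).
  by rewrite (frame_ra F1 (x := 0) isT).
apply: term_seq => //; apply: term_weaken (darts_spec d0 q0 q1 q5 qe1 qe2 qw).
  exact: b1.
move=> s2 F2 [[sM sdarts] soff].
have tlE (j : 'I_M) : iarr s2 5 j = dtail (lab j).
  by have [-> _ _] := sdarts j (ltn_ord j); rewrite labE ntailE.
have hdE (j : 'I_M) : iarr s2 6 j = dhead (lab j).
  by have [_ -> _] := sdarts j (ltn_ord j); rewrite labE nheadE.
have wtE (j : 'I_M) : rarr s2 2 j = weight (lab j).1.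
  by have [_ _ ->] := sdarts j (ltn_ord j); rewrite labE /= tabulateE.
have tl_lt j (jM : j < M) : iarr s2 5 j < n by rewrite (tlE (Ordinal jM)).
have hd_lt j (jM : j < M) : iarr s2 6 j < n by rewrite (hdE (Ordinal jM)).
have wt_ge0 j (jM : j < M) : (0 <= rarr s2 2 j)%R by rewrite (wtE (Ordinal jM)) weight_ge0.
have off_mono u : u < n -> iarr s2 4 u <= iarr s2 4 u.+1.
  by move=> un; rewrite (soff _ (ltnW un)) (soff _ un) grouped_mono.
have off_tl j : j < M -> iarr s2 4 (iarr s2 5 j) <= j < iarr s2 4 (iarr s2 5 j).+1.
  move=> jM; have tn := tl_lt j jM; rewrite (soff _ (ltnW tn)) (soff _ tn).
  apply: (grouped_range (d0 := d0) jM).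
  by have [-> _ _] := sdarts j jM.
have off_tl' u j : u < n -> iarr s2 4 u <= j < iarr s2 4 u.+1 -> j < M /\ iarr s2 5 j = u.
  move=> un; rewrite (soff _ (ltnW un)) (soff _ un) => uj; have jM : j < M.
    case/andP: uj => _ /leq_trans; apply; rewrite !size_grouped; apply: sub_count => d /= du.
    by apply: leq_trans du un.
  by split=> //; have [-> _ _] := sdarts j jM; apply: nth_grouped uj.
have keep x : x \in [:: 2; 3; 9; 12] -> iarr s2 x = iarr s0 x.
  rewrite !inE => /or4P[]/eqP->;
    by rewrite (frame_ia F2) // (frame_ia F1).
have [t0 t3 t4 tk] : [/\ ivar s2 0 = n, ivar s2 3 = source G, ivar s2 4 = target G & ivar s2 2 = k].
  rewrite (frame_i F2 (x := 0) isT) (frame_i F1 (x := 0) isT).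
  rewrite (frame_i F2 (x := 3) isT) (frame_i F1 (x := 3) isT).
  rewrite (frame_i F2 (x := 4) isT) (frame_i F1 (x := 4) isT).
  by rewrite (frame_i F2 (x := 2) isT) (frame_i F1 (x := 2) isT).
have keepr x : x \in [:: 1; 3; 6] -> rarr s2 x = rarr s0 x.
  rewrite !inE => /or3P[]/eqP->;
    by rewrite (frame_ra F2) // (frame_ra F1).
have con_init u : iarr s2 9 u = 0 by rewrite keep.
have H_init u : rarr s2 3 u = 0%R by rewrite keepr.
apply: term_seq => //; apply: term_weaken (component_spec lab_onto tlE hdE wtE
  t0 t3 sM erefl erefl erefl con_init H_init).
  exact: b2.
move=> s3 F3 C3.
set con0 := iarr s3 9; set H := rarr s3 3 in C3 *.
have con_walk (u : 'I_n) : con con0 u -> exists c, walk (V (source G)) (V u) c.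
  by move=> /(C3 u).1 W; exists (H u).
have con_closed (u : 'I_n) c : walk (V (source G)) (V u) c -> con con0 u.
  exact: (C3 u).2.
have S3 : static n M (iarr s2 4) (iarr s2 5) (iarr s2 6) (iarr s1 7) (iarr s1 8) (rarr s2 2) H s3.
  split; rewrite ?(frame_i F3 (x := 0) isT) ?(frame_i F3 (x := 5) isT) //.
  - by rewrite (frame_ia F3).
  - by rewrite (frame_ia F3).
  - by rewrite (frame_ia F3).
  - by rewrite (frame_ia F3) // (frame_ia F2).
  - by rewrite (frame_ia F3) // (frame_ia F2).
  - by rewrite (frame_ra F3).
(* Outside the component array 3 keeps its initial zeros and keys mean nothing, so [P] asks for a
   walk only between vertices of the component. *)
pose P (u w : nat) (x : R) := forall a b : 'I_n, a = u :> nat -> b = w :> nat ->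
  con con0 a -> con con0 b -> walk (V a) (V b) x.
have P_step u j x : u < n -> j < M -> P u (iarr s2 5 j) x -> P u (iarr s2 6 j) (x + rarr s2 2 j)%R.
  move=> un jM Px a b Ea Eb ca cb; set jo := Ordinal jM.
  have Wd := walk_head (lab := lab) (j := jo) (walk_nil (V (dtail (lab jo)))).
  have Eb' : b = dhead (lab jo) by apply: ord_inj; rewrite Eb -hdE.
  rewrite -Eb' in Wd; have [c Wb] := con_walk b cb.
  have ct := con_closed _ _ (walk_cat Wb (walk_rev Wd)).
  by rewrite Eb' (wtE jo); apply: walk_head; apply: Px => //; rewrite -tlE.
have P_src u : u < n -> P u u 0%R.
  move=> un a b Ea Eb _ _; have -> : a = b by apply: ord_inj; rewrite Ea.
  by constructor.
have P_init u w : u < n -> w < n -> P u w (H u + H w)%R.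
  move=> un wn a b <- <- /(C3 a).1 Wa /(C3 b).1 Wb.
  by apply: walk_cat Wb; apply: walk_rev.
have half2 i : i < n + n -> iarr s1 8 i = i./2 by exact: half1.
have off0 : iarr s2 4 0 = 0 by rewrite soff.
have offn : iarr s2 4 n = M by rewrite soff.
apply: term_seq => //; apply: term_weaken (all_pairs_spec n0 nL half2 row1 off_mono off0 offn
  tl_lt hd_lt off_tl off_tl' wt_ge0 P_step P_src P_init S3); first exact: b3.
move=> s4 F4 rows; have S4 := static_frame F4 isT S3.
set D0 := rarr s4 5 in rows *.
have D_walk (u w : 'I_n) : con con0 u -> con con0 w -> walk (V u) (V w) (D G D0 u w).
  by move=> cu cw; have [_ H1 _] := rows u (ltn_ord u); apply: (H1 w (ltn_ord w)).
(* [row_ok] gives only [<= 0]; as the length of a walk the entry is also non-negative. *)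
have D_diag (u : 'I_n) : con con0 u -> D G D0 u u = 0%R.
  move=> cu; have [H1 _ _] := rows u (ltn_ord u); apply/eqP; rewrite eq_le H1.
  exact: walk_ge0 (D_walk u u cu cu).
have D_dart (u : 'I_n) d : con con0 u ->
    (D G D0 u (@dhead _ G d) <= D G D0 u (dtail d) + weight d.1)%R.
  move=> _; have [_ _ H1] := rows u (ltn_ord u); have [j <-] := lab_onto d.
  by have := H1 j (ltn_ord j); rewrite tlE hdE wtE.
have [u0 u3 u4 uk] : [/\ ivar s4 0 = n, ivar s4 3 = source G, ivar s4 4 = target G & ivar s4 2 = k].
  rewrite (frame_i F4 (x := 0) isT) (frame_i F4 (x := 3) isT).
  rewrite (frame_i F4 (x := 4) isT) (frame_i F4 (x := 2) isT).
  rewrite (frame_i F3 (x := 0) isT) (frame_i F3 (x := 3) isT).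
  by rewrite (frame_i F3 (x := 4) isT) (frame_i F3 (x := 2) isT).
apply: term_seq => //; apply: term_run => //=; rewrite u3; set s5 := set_iarr _ _ _ _.
have E5 : env G M (iarr s2 4) (iarr s2 5) (iarr s2 6) (iarr s1 7) (iarr s1 8) con0 (rarr s2 2) H D0 s5.
  split=> //=.
  - by case: S4.
  - by rewrite (frame_ia F4).
  - by rewrite (frame_ia F4) // (frame_ia F3) // keep.
  - by rewrite (frame_ia F4) // (frame_ia F3) // keep.
  - by rewrite (frame_ra F4) // (frame_ra F3) // keepr.
have reach5 u : reachf s5 u = (u == source G).
  rewrite /reachf /=; case: eqP => // _.
  by rewrite (frame_ia F4) // (frame_ia F3) // keep.
have a5 u : rarr s5 6 u = 0%R.
  by rewrite /= (frame_ra F4) // (frame_ra F3) // keepr.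
have sol0 : solved v con0 lab [::] s5.
  split; first split.
  - move=> u; rewrite (reach5 u) => /eqP/ord_inj->; constructor.
  - move=> j; rewrite reach5 => /eqP/ord_inj Ej; exists 0%R.
    by rewrite lexx ler01 mul0r a5 dpoint0 Ej; split=> //; constructor.
  - move=> u; rewrite (reach5 u) => /eqP/ord_inj->; apply: (con_closed _ 0%R); constructor.
  - by move=> j _; rewrite a5.
  - by move=> q Hq; inversion Hq; subst; rewrite /= (reach5 _) eqxx.
pose turns := [seq turn G j | j <- enum 'I_k].
have sturns : size turns = k by rewrite size_map size_enum_ord.
apply: term_seq => //.
apply: (@term_for _ 6 2 _ s5 k (n * (n + M + 1) + M + 2) _
  (fun j s => solved v con0 lab (take j turns) s)) => //.
- by case: (v).
- by case: (v).
- by rewrite addnS.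
- by rewrite take0.
- move=> s6 /frame_round F6 [Hs Hc]; apply: term_run => //.
  rewrite take_oversize ?sturns // in Hs Hc.
  rewrite /accepts /= (frame_i F6 (x := 4) isT) /= u4 -lt0n.
  split=> [acc|/Hc //]; have [Hr _ _ _] := Hs; exact: Hr.
- move=> j s6 jk /frame_round F6 s6j sol; have E6 := env_frame F6 isT E5.
  rewrite (take_nth (turn G (Ordinal jk))) ?sturns //.
  rewrite (nth_map (Ordinal jk)) ?size_enum_ord // (nth_ord_enum _ (Ordinal jk)).
  exact: (round_spec row1 tlE hdE wtE lab_onto con_walk con_closed D_diag D_dart D_walk E6
    (j := Ordinal jk) s6j sol).
Qed.

End Delivery.

Theorem theorem6 (v : version) :
  exists (p : cmd) (c : nat),
  forall (R : realFieldType) (G : instance R),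
  exists (T : nat) (s : state R),
    exec p (input G) T s
    /\ (accepts s <-> fixed_order_delivery G v)
    /\ (0 < nA G ->
        T <= c * (nA G * (nV G + nE G) * (nV G * trunc_log 2 (nV G) + nE G)))%N.
Proof.
exists (delivery v), (weightc (delivery v) * 50) => R G.
have [T [s [E TF acc]]] := delivery_spec G v.
exists T, s; split=> //; split=> // k0; apply: leq_trans TF _.
rewrite -mulnA leq_mul2l delivery_time_le ?orbT //.
(* Distinct source and target provide the two vertices that the time bound asks for. *)
have := source_neq_target G; rewrite -val_eqE /=.
by have := ltn_ord (source G); have := ltn_ord (target G); lia.
Qed.
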